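(* There exists a constant $C>0$ such that $$|G(x,t)|\le C\,(1+|t|)^{-\frac32}\log(2+|t|)\qquad\text{for all }(x,t)\in\mathbb{Z}^4\times\mathbb{R},$$ where $G$ is the Green's function of the discrete wave equation on $\mathbb{Z}^4$.
   Context: Let $\mathbb{T}^4=[-\pi,\pi]^4$, $\omega(\xi)=\big(\sum_{j=1}^{4}(2-2\cos\xi_j)\big)^{1/2}$, and $x\cdot\xi=\sum_{j=1}^4x_j\xi_j$. The Green's function of the discrete wave equation $\partial_t^2u-\Delta u=0$ on $\mathbb{Z}^4$ (zero initial position, initial velocity a delta at the origin, $\Delta u(x)=\sum_{|y-x|_1=1}(u(y)-u(x))$) is $$G(x,t)=\frac{1}{(2\pi)^4}\int_{\mathbb{T}^4}e^{ix\cdot\xi}\,\frac{\sin(t\,\omega(\xi))}{\omega(\xi)}\,d\xi,\qquad (x,t)\in\mathbb{Z}^4\times\mathbb{R}.$$ *)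

(* Defs.v *)
From HB Require Import structures.
From mathcomp Require Import all_boot all_order all_algebra.
From mathcomp Require Import all_classical all_reals all_analysis.
From mathcomp Require Import complex.

Set Implicit Arguments.
Unset Strict Implicit.
Unset Printing Implicit Defensive.

Import Order.TTheory GRing.Theory Num.Theory.
Import numFieldNormedType.Exports.

Local Open Scope classical_set_scope.
Local Open Scope ring_scope.
Local Open Scope complex_scope.

Section DiscreteWave.
Variable R : realType.

Local Notation mR := (measurableTypeR R).

(* R^4 as a measurable space is the iterated product, since the library has
   no Lebesgue measure on 'rV[R]_4; [vec4] gives access to the coordinates. *)
Local Notation R4 := (mR * mR * mR * mR)%type.

Definition vec4 (p : R4) : 'rV[R]_4 :=
  let: (a, b, c, d) := p in \row_j tnth [tuple a; b; c; d] j.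

Local Notation leb := (@lebesgue_measure R).

Definition lebesgue4 : {measure set R4 -> \bar R} :=
  (leb \x leb \x leb \x leb)%E.

Definition torus4 : set R4 :=
  let I := [set` `[- pi, pi]] in I `*` I `*` I `*` I.

Definition omega (xi : 'rV[R]_4) : R :=
  Num.sqrt (\sum_(j < 4) (2 - 2 * cos (xi 0 j))).

Definition dot4 (x : 'rV[int]_4) (xi : 'rV[R]_4) : R :=
  \sum_(j < 4) (x 0 j)%:~R * xi 0 j.

Definition expi (theta : R) : R[i] := cos theta +i* sin theta.

Definition Cintegral d (T : measurableType d) (mu : {measure set T -> \bar R})
    (D : set T) (f : T -> R[i]) : R[i] :=
  (\int[mu]_(p in D) complex.Re (f p)) +i* (\int[mu]_(p in D) complex.Im (f p)).

(* At the zeros of omega (a null subset of the torus) the quotient is 0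
   because 0^-1 = 0; this does not affect the integral. *)
Definition green (x : 'rV[int]_4) (t : R) : R[i] :=
  (((2 * pi) ^+ 4)^-1)%:C *
  Cintegral lebesgue4 torus4 (fun p =>
    expi (dot4 x (vec4 p)) * (sin (t * omega (vec4 p)) / omega (vec4 p))%:C).

End DiscreteWave.

(* Main.v *)
Require Import Defs.
From HB Require Import structures.
From mathcomp Require Import all_boot all_order all_algebra.
From mathcomp Require Import all_classical all_reals all_analysis.
From mathcomp Require Import measurable_realfun complex.
From mathcomp Require Import ring lra.

Import Order.TTheory GRing.Theory Num.Theory.
Import numFieldNormedType.Exports.
Local Open Scope ring_scope.
Local Open Scope complex_scope.

(** The square of the frequency, [lambda = omega ^ 2 = sum_j (2 - 2 cos xi_j)],
    is a sum of functions of one variable, so the integral of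
    [exp (i (x . xi + s lambda))] over the torus is a product of four integrals
    over one period, which are Bessel functions of order [x_j] at [2 s].  The proof
    writes [sin (t omega) / omega] as a superposition of the functions
    [exp (i s lambda)] and inserts absolute values after using this product.

    The superposition is the Cauchy-Schlomilch identity
    [omega sqrt t int_0^oo cos (t (1 / (4 tau ^ 2) + lambda tau ^ 2) + al) dtau
     = kappa (al + t omega)], where [kappa al] is the improper Fresnel integral of
    [cos (v ^ 2 + al)] over the half-line ([schlomilch_integral],
    [schlomilch_cvg]).  Two values of [al] recover the sine, because [kappa] is a
    nonzero combination of sine and cosine ([kappa_sin], [fresnel_cos_gt0]).

    Since [lambda <= 16], the phase is stationary only at
    [tau = (4 lambda) ^ (-1/4) > 1/4].  The part [tau < 1/4], suitably cut off, is
    therefore of size [sqrt t * t ^ -2] after two integrations by parts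
    ([cutoff_integral_bound]).

    In the remaining part the oscillation in [tau] is not used at all.  With
    [s = t tau ^ 2], the product of the four period integrals is at most the mean of
    their fourth powers, and van der Corput's lemma gives
    [|I_n s| ^ 4 <= C s ^ -2 / |1 - |n| / (2 s)|] ([period_norm_bound]).  The square
    root of a square root that describes the transition region of a Bessel function
    becomes a simple pole when raised to the fourth power, so its integral over
    [tau], cut off at distance [t ^ -2] from the pole by the trivial bound, costs
    one logarithm: it is at most [C t ^ -2 log (2 + t)], uniformly in [n]
    ([period_norm4_majorant], [majorant_integral]).  With the factor [sqrt t] this is
    the rate [t ^ (-3/2) log (2 + t)] ([truncation_bound]).

    All of this is done for [tau] in [[1/N, N]].  The limit [N -> oo] is taken by
    dominated convergence over the torus, where [1 / omega] is integrable
    ([truncation_integral_cvg]). *)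

Set Implicit Arguments.
Unset Strict Implicit.

(** * Calculus on segments *)

Section Calculus.
Local Open Scope classical_set_scope.
Context (R : realType).
Implicit Types (f g F : R -> R) (x a b c : R).

(** A plain constant instead of the class [is_derive]: a derivative is then computed
    only by the rules below, and in the syntactic form that they produce. *)
Definition has_deriv x f a := is_derive x 1 f a.

Lemma der_cst x c : has_deriv x (fun=> c) 0.
Proof. exact: is_derive_cst. Qed.

Lemma derD f g x a b : has_deriv x f a -> has_deriv x g b ->
  has_deriv x (fun y => f y + g y) (a + b).
Proof. exact: is_deriveD. Qed.

Lemma derN f x a : has_deriv x f a -> has_deriv x (fun y => - f y) (- a).
Proof. exact: is_deriveN. Qed.

Lemma derM f g x a b : has_deriv x f a -> has_deriv x g b ->
  has_deriv x (fun y => f y * g y) (f x * b + g x * a).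
Proof. exact: is_deriveM. Qed.

Lemma derX f x a n : has_deriv x f a ->
  has_deriv x (fun y => f y ^+ n) (n%:R * f x ^+ n.-1 * a).
Proof.
move=> fa; elim: n => [|n IH].
  by rewrite mul0r mul0r; have := der_cst x 1; congr (is_derive _ _ _ _); apply/funext.
have := derM fa IH; rewrite (_ : (fun y => _) = fun y => f y ^+ n.+1); last first.
  by apply/funext => y; rewrite exprS.
move=> /is_derive_eq; apply; case: n {IH} => [|n]; first by rewrite !expr0; ring.
by rewrite /= -[n.+2]addn1 natrD exprS; ring.
Qed.

Lemma derV f x a : f x != 0 -> has_deriv x f a ->
  has_deriv x (fun y => (f y)^-1) (- (f x) ^- 2 * a).
Proof. exact: is_deriveV. Qed.

Lemma der_cos f x a : has_deriv x f a ->
  has_deriv x (fun y => cos (f y)) (- sin (f x) * a).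
Proof. move=> fa; exact: is_derive1_comp. Qed.

Lemma der_sin f x a : has_deriv x f a ->
  has_deriv x (fun y => sin (f y)) (cos (f x) * a).
Proof. move=> fa; exact: is_derive1_comp. Qed.

Lemma der_ln f x a : 0 < f x -> has_deriv x f a ->
  has_deriv x (fun y => ln (f y)) ((f x)^-1 * a).
Proof.
move=> f0 fa.
by refine (@is_derive1_comp _ (@ln R) f x _ _ (is_derive1_ln f0) fa).
Qed.

Lemma der_sqrt f x a : 0 < f x -> has_deriv x f a ->
  has_deriv x (fun y => Num.sqrt (f y)) ((2 * Num.sqrt (f x))^-1 * a).
Proof.
move=> f0 fa.
by refine (@is_derive1_comp _ (@Num.sqrt R) f x _ _ (is_derive1_sqrt f0) fa).
Qed.

Lemma der_atan f x a : has_deriv x f a ->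
  has_deriv x (fun y => atan (f y)) ((1 + f x ^+ 2)^-1 * a).
Proof.
move=> fa.
by refine (@is_derive1_comp _ (@atan R) f x _ _ (is_derive1_atan (f x)) fa).
Qed.

Lemma der_comp F f x a b : has_deriv (f x) F b -> has_deriv x f a ->
  has_deriv x (fun y => F (f y)) (b * a).
Proof. by move=> Fb fa; refine (@is_derive1_comp _ F f x _ _ Fb fa). Qed.

Lemma der_id x : has_deriv x (fun y => y) 1.
Proof. exact: is_derive_id. Qed.

Lemma der_eq f x a b : has_deriv x f a -> a = b -> has_deriv x f b.
Proof. by move=> + <-. Qed.

Lemma der_cont f x a : has_deriv x f a -> {for x, continuous f}.
Proof. by move=> [fx _]; exact/differentiable_continuous/derivable1_diffP. Qed.

Lemma within_cont f a b : (forall x, a <= x <= b -> {for x, continuous f}) ->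
  {within `[a, b], continuous f}.
Proof.
move=> H; apply: continuous_in_subspaceT => x; rewrite inE/= in_itv/=; exact: H.
Qed.

Local Notation leb := (@lebesgue_measure R).

Lemma cont_integrable f a b : (forall x, a <= x <= b -> {for x, continuous f}) ->
  leb.-integrable `[a, b] (EFin \o f).
Proof.
move=> cf; apply: continuous_compact_integrable; first exact: segment_compact.
exact: within_cont.
Qed.

Lemma FTC f F a b : a <= b ->
  (forall x, a <= x <= b -> has_deriv x F (f x)) ->
  (forall x, a <= x <= b -> {for x, continuous f}) ->
  \int[leb]_(x in `[a, b]) f x = F b - F a.
Proof.
rewrite le_eqVlt => /orP[/eqP <- _ _|ab dF cf].
  by rewrite set_itv1 Rintegral_set1 subrr.
rewrite /Rintegral (@continuous_FTC2 _ _ F)//; first exact: within_cont.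
  split.
  - move=> x /[!in_itv]/= /andP[ax xb].
    have h : a <= x <= b by rewrite !ltW.
    by have [] := dF _ h.
  - apply: cvg_at_right_filter; apply: der_cont (dF _ _).
    by rewrite lexx ltW.
  - apply: cvg_at_left_filter; apply: der_cont (dF _ _).
    by rewrite lexx ltW.
move=> x /[!in_itv]/= /andP[ax xb].
have h : a <= x <= b by rewrite !ltW.
by rewrite derive1E; have [_ ->] := dF _ h.
Qed.

Lemma integral_split f a b c : a <= b -> b <= c ->
  leb.-integrable `[a, c] (EFin \o f) ->
  \int[leb]_(x in `[a, c]) f x =
  \int[leb]_(x in `[a, b]) f x + \int[leb]_(x in `[b, c]) f x.
Proof.
move=> ab bc fi.
have h := @Rintegral_itvB _ f (BLeft a) (BRight c) b fi.
rewrite -(@Rintegral_itv_obnd_cbnd _ b (BRight c)); last first.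
  by apply: integrableS fi => //; apply: subset_itvr; rewrite bnd_simp.
by rewrite -h ?bnd_simp// addrC subrK.
Qed.

Lemma norm_integral_le f a b M : a <= b ->
  leb.-integrable `[a, b] (EFin \o f) ->
  (forall x, a <= x <= b -> `|f x| <= M) ->
  `|\int[leb]_(x in `[a, b]) f x| <= M * (b - a).
Proof.
move=> ab fi fM.
apply: (le_trans (le_normr_Rintegral _ fi)) => //.
have -> : M * (b - a) = \int[leb]_(x in `[a, b]) M.
  rewrite Rintegral_cst//; congr (_ * _).
  rewrite /= lebesgue_measure_itv/= lte_fin; case: ltP => //= ba.
  by rewrite (@le_anti _ _ b a) ?subrr// ab ba.
apply: le_Rintegral => //.
- have := integrable_norm fi; by [].
- apply: cont_integrable => x _; exact: cst_continuous.
Qed.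

End Calculus.

Ltac der := repeat first
  [ apply: derD | apply: derN | apply: derM | apply: derX | apply: der_cos
  | apply: der_sin | apply: der_cst | apply: der_id ].

Section VdC.
Local Open Scope classical_set_scope.
Context (R : realType).
Implicit Types (f g F : R -> R) (x a b c : R).
Local Notation leb := (@lebesgue_measure R).

(** The integral from a base point to [x] is differentiable at [x] only if the base
    point lies to the left of [x].  Letting the base point depend on [x], and
    subtracting the value at [0], gives one primitive on the whole line. *)
Lemma primitive_exists f : continuous f ->
  {F : R -> R | F 0 = 0 & forall x, has_deriv x F (f x)}.
Proof.
move=> cf.
pose I (l x : R) := \int[leb]_(y in `[l, x]) f y.
pose F x := I (- (`|x| + 1)) x - I (- (`|x| + 1)) 0.
have If (l u : R) : leb.-integrable `[l, u] (EFin \o f).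
  by apply: cont_integrable => x _; exact: cf.
(* The value of [F] at [x] does not depend on the base point, as long as it lies
below [x] and [0]. *)
have FE (L x : R) : `|x| + 1 <= L -> F x = I (- L) x - I (- L) 0.
  move=> xL; rewrite /F /I.
  have nx := ler_norm x; have nnx := ler_norm (- x); rewrite normrN in nnx.
  have n0 := normr_ge0 x.
  rewrite (@integral_split _ f (- L) (- (`|x| + 1)) x)//; [|lra..].
  rewrite (@integral_split _ f (- L) (- (`|x| + 1)) 0)//; [|lra..].
  ring.
exists F.
  by rewrite /F subrr.
move=> x.
pose L := `|x| + 2.
have nx := ler_norm x; have nnx := ler_norm (- x); rewrite normrN in nnx.
have n0 := normr_ge0 x.
have [dI I'] : derivable (I (- L)) x 1 /\ (I (- L))^`() x = f x.
  apply: (@continuous_FTC1_closed _ f (- L) x (x + 1)) => //.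
  - lra.
  - rewrite /L; lra.
  - exact: cf.
have dG : has_deriv x (fun y => I (- L) y - I (- L) 0) (f x).
  have dIx : has_deriv x (I (- L)) (f x) by split; [exact: dI|rewrite -derive1E; exact: I'].
  by apply: (der_eq (derD dIx (der_cst x _))); rewrite addr0.
apply: near_eq_is_derive dG.
  near=> y; apply/esym/FE; rewrite /L.
  suff : `|y - x| <= 1 by move=> h; have := ler_normD (y - x) x; rewrite subrK; lra.
  rewrite distrC; near: y; apply/nbhs_ballP; exists 1 => //= y; rewrite /ball/=.
  exact: ltW.
Unshelve. all: by end_near. Qed.

Lemma mean_value f (df : R -> R) a b : a <= b ->
  (forall x, a <= x <= b -> has_deriv x f (df x)) ->
  exists2 c, a <= c <= b & f b - f a = df c * (b - a).
Proof.
move=> ab dff.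
have [||c + ->] := @MVT_segment _ f df a b ab.
- move=> x; rewrite in_itv/= => /andP[? ?]; apply: dff; rewrite !ltW//.
- by apply: within_cont => x /dff; exact: der_cont.
by rewrite in_itv/= => ?; exists c.
Qed.

(** * Elementary bounds for sine and cosine *)

Lemma norm_sin_le x : `|sin x| <= `|x|.
Proof.
wlog x0 : x / 0 <= x.
  move=> H; have [|/ltW x0] := leP 0 x; first exact: H.
  by rewrite -normrN -sinN -[leRHS]normrN; apply: H; rewrite oppr_ge0.
have [c _] := @mean_value sin cos 0 x x0 (fun y _ => is_derive_sin y).
by rewrite sin0 !subr0 => ->; rewrite normrM ler_piMl// cos_max.
Qed.

(** Turns bounds for [1 - cos x] into bounds for a sine. *)
Lemma cos_half x : cos x = 1 - 2 * sin (x / 2) ^+ 2.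
Proof.
have -> : x = (x / 2) *+ 2 by rewrite mulr2n; field.
rewrite cos_mulr2n cos2sin2 (_ : (x / 2) *+ 2 / 2 = x / 2); last first.
  by rewrite mulr2n; field.
by rewrite mulr2n; ring.
Qed.

Lemma cos_ge_quadratic x : 1 - x ^+ 2 / 2 <= cos x.
Proof.
rewrite cos_half.
have : sin (x / 2) ^+ 2 <= (x / 2) ^+ 2.
  rewrite -[leLHS]real_normK ?num_real// -[leRHS]real_normK ?num_real//.
  by rewrite lerXn2r ?nnegrE// norm_sin_le.
have -> : (x / 2) ^+ 2 = x ^+ 2 / 4 by field.
lra.
Qed.

Lemma sin_ge_half x : 0 <= x <= 1 -> x / 2 <= sin x.
Proof.
move=> /andP[x0 x1]; have [c /andP[c0 cx]] := @mean_value sin cos 0 x x0 (fun y _ => is_derive_sin y).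
rewrite sin0 !subr0 => ->; rewrite mulrC; apply: ler_wpM2r => //.
have := cos_ge_quadratic c; have : c ^+ 2 <= 1 by rewrite expr_le1//; lra.
lra.
Qed.

(** * Van der Corput's lemma *)

(** Integrate by parts, writing [cos phi = (sin phi)' / phi'].  The new integrand is
    at most [|phi''| / phi' ^ 2], and since [phi'] is monotone this is the absolute value
    of an exact derivative; the three contributions add up to twice the larger of
    the values of [1 / phi'] at the ends.  The constant [2] is sharp enough for
    [fresnel_cos_gt0]. *)
Lemma van_der_corput_first (phi dphi ddphi : R -> R) a b m : a <= b -> 0 < m ->
  (forall x, a <= x <= b -> has_deriv x phi (dphi x)) ->
  (forall x, a <= x <= b -> has_deriv x dphi (ddphi x)) ->
  (forall x, a <= x <= b -> {for x, continuous ddphi}) ->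
  (forall x, a <= x <= b -> m <= dphi x) ->
  (forall x, a <= x <= b -> ddphi x <= 0) \/
  (forall x, a <= x <= b -> 0 <= ddphi x) ->
  `|\int[leb]_(x in `[a, b]) cos (phi x)| <= 2 / m.
Proof.
move=> ab m0 d1 d2 cd dm sgn.
have dn0 x : a <= x <= b -> dphi x != 0.
  by move=> h; rewrite gt_eqF// (lt_le_trans m0)// dm.
(* The derivative of [- 1 / dphi]; its sign is constant. *)
pose q x := ddphi x * (dphi x ^- 2).
have cq x : a <= x <= b -> {for x, continuous q}.
  move=> h; apply: continuousM; first exact: cd.
  apply: (@continuousV _ _ (fun x => dphi x ^+ 2)).
    by rewrite expf_neq0// dn0.
  by apply: der_cont; apply: derX; exact: d2.
have cc x : a <= x <= b -> {for x, continuous (fun x => cos (phi x))}.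
  by move=> h; apply: der_cont; apply: der_cos; exact: d1.
have cs x : a <= x <= b -> {for x, continuous (fun x => sin (phi x))}.
  by move=> h; apply: der_cont; apply: der_sin; exact: d1.
have csq x : a <= x <= b -> {for x, continuous (fun x => sin (phi x) * q x)}.
  by move=> h; apply: continuousM; [exact: cs|exact: cq].
have E1 : \int[leb]_(x in `[a, b]) (cos (phi x) - sin (phi x) * q x) =
    sin (phi b) / dphi b - sin (phi a) / dphi a.
  apply: (@FTC _ _ (fun x => sin (phi x) / dphi x)) => // x h.
    apply: der_eq.
      apply: derM; first by apply: der_sin; exact: d1.
      by apply: derV; [exact: dn0|exact: d2].
    by rewrite /q; field; exact: dn0.
  by apply: continuousB; [exact: cc|exact: csq].
rewrite RintegralB// in E1; [|exact: cont_integrable..].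
have E2 : \int[leb]_(x in `[a, b]) q x = (dphi a)^-1 - (dphi b)^-1.
  transitivity (- (dphi b)^-1 - - (dphi a)^-1); last by ring.
  apply: (@FTC _ _ (fun x => - (dphi x)^-1)) => // x h.
  apply: der_eq.
    by apply: derN; apply: derV; [exact: dn0|exact: d2].
  by rewrite /q; field; exact: dn0.
have E3 : `|\int[leb]_(x in `[a, b]) (sin (phi x) * q x)| <=
    `|\int[leb]_(x in `[a, b]) q x|.
  apply: (le_trans (le_normr_Rintegral _ _)) => //; first exact: cont_integrable.
  have -> : `|\int[leb]_(x in `[a, b]) q x| = \int[leb]_(x in `[a, b]) `|q x|.
    case: sgn => sgn.
      have e x : a <= x <= b -> q x = - `|q x|.
        move=> h; rewrite ler0_norm ?opprK// /q mulr_le0_ge0//; first exact: sgn.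
        by rewrite invr_ge0 sqr_ge0.
      rewrite (_ : \int[leb]_(x in `[a, b]) q x =
                   - \int[leb]_(x in `[a, b]) `|q x|).
        rewrite normrN ger0_norm//; apply: Rintegral_ge0 => //.
      rewrite -mulN1r -RintegralZl//.
        by apply: eq_Rintegral => x; rewrite inE/= in_itv/= mulN1r => /e.
      by have := integrable_norm (cont_integrable cq).
    have e x : a <= x <= b -> q x = `|q x|.
      move=> h; rewrite ger0_norm// /q mulr_ge0//; first exact: sgn.
      by rewrite invr_ge0 sqr_ge0.
    rewrite (_ : \int[leb]_(x in `[a, b]) q x = \int[leb]_(x in `[a, b]) `|q x|).
      by rewrite ger0_norm//; apply: Rintegral_ge0 => //.
    by apply: eq_Rintegral => x; rewrite inE/= in_itv/= => /e.
  apply: le_Rintegral => //.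
  - by have := integrable_norm (cont_integrable csq).
  - by have := integrable_norm (cont_integrable cq).
  - by move=> x _; rewrite normrM ler_piMl// sin_max.
have ha : 0 < (dphi a)^-1 <= m^-1.
  have h : a <= a <= b by rewrite lexx.
  by rewrite invr_gt0 lef_pV2 ?posrE ?dm// ?andbT (lt_le_trans m0)// dm.
have hb : 0 < (dphi b)^-1 <= m^-1.
  have h : a <= b <= b by rewrite lexx ab.
  by rewrite invr_gt0 lef_pV2 ?posrE ?dm// ?andbT (lt_le_trans m0)// dm.
move: E1 E2 E3.
set I := \int[leb]_(x in _) cos _; set J := \int[leb]_(x in _) (_ * _).
move=> /eqP; rewrite subr_eq => /eqP -> -> E3.
have end_le x : a <= x <= b -> `|sin (phi x) / dphi x| <= (dphi x)^-1.
  move=> h; have d0 : 0 <= (dphi x)^-1 by rewrite invr_ge0 (le_trans (ltW m0))// dm.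
  by rewrite normrM (ger0_norm d0) ler_piMl// sin_max.
have sa : `|sin (phi a) / dphi a| <= (dphi a)^-1 by rewrite end_le// lexx.
have sb : `|sin (phi b) / dphi b| <= (dphi b)^-1 by rewrite end_le// lexx ab.
move: ha hb sa sb E3 => /andP[a0 am] /andP[b0 bm].
rewrite !ler_norml => /andP[? ?] /andP[? ?] /andP[].
have [h|h] := leP (dphi b)^-1 (dphi a)^-1.
  rewrite ger0_norm ?subr_ge0// => ? ?; apply/andP; split; lra.
rewrite ltr0_norm ?subr_lt0// => ? ?; apply/andP; split; lra.
Qed.

Lemma van_der_corput_first_neg (phi dphi ddphi : R -> R) a b m : a <= b -> 0 < m ->
  (forall x, a <= x <= b -> has_deriv x phi (dphi x)) ->
  (forall x, a <= x <= b -> has_deriv x dphi (ddphi x)) ->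
  (forall x, a <= x <= b -> {for x, continuous ddphi}) ->
  (forall x, a <= x <= b -> dphi x <= - m) ->
  (forall x, a <= x <= b -> ddphi x <= 0) ->
  `|\int[leb]_(x in `[a, b]) cos (phi x)| <= 2 / m.
Proof.
move=> ab m0 d1 d2 cd dm sgn.
under eq_Rintegral do rewrite -cosN.
apply: (@van_der_corput_first _ (fun x => - dphi x) (fun x => - ddphi x)) => //.
- by move=> x h; apply: derN; exact: d1.
- by move=> x h; apply: derN; exact: d2.
- by move=> x h; apply: continuousN; exact: cd.
- by move=> x h; rewrite lerNr dm.
- by right => x h; rewrite oppr_ge0 sgn.
Qed.

(** The bound on [phi''] makes [phi'] grow linearly away from its zero, so that at
    distance [r] from it the first derivative is at least [1 / r] and
    [van_der_corput_first] applies; the interval within distance [r] of the zero is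
    estimated by its length.  The two sides of the zero contribute [3 r] each. *)
Lemma van_der_corput_second (phi dphi ddphi : R -> R) a b r : a <= b -> 0 < r ->
  (forall x, a <= x <= b -> has_deriv x phi (dphi x)) ->
  (forall x, a <= x <= b -> has_deriv x dphi (ddphi x)) ->
  (forall x, a <= x <= b -> {for x, continuous ddphi}) ->
  (forall x, a <= x <= b -> ddphi x <= - r ^- 2) ->
  `|\int[leb]_(x in `[a, b]) cos (phi x)| <= 6 * r.
Proof.
move=> ab r0 d1 d2 cd dm.
have r2 : 0 < r ^- 2 by rewrite invr_gt0 exprn_gt0.
have rr : r * r ^- 2 = r^-1 by field; rewrite gt_eqF.
have int x y : a <= x -> y <= b ->
    leb.-integrable `[x, y] (EFin \o (fun x => cos (phi x))).
  move=> ax yb; apply: cont_integrable => z /andP[xz zy].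
  by apply: der_cont; apply: der_cos; apply: d1; rewrite (le_trans ax)// (le_trans zy).
have triv x y : a <= x -> x <= y -> y <= b -> y - x <= r ->
    `|\int[leb]_(x in `[x, y]) cos (phi x)| <= r.
  move=> ax xy yb yxr; apply: (le_trans (norm_integral_le (M := 1) _ _ _)) => //.
  - exact: int.
  - by move=> *; exact: cos_max.
  - by rewrite mul1r.
have sub x y z : a <= x -> y <= b -> x <= z <= y -> a <= z <= b.
  by move=> ax yb /andP[xz zy]; rewrite (le_trans ax)// (le_trans zy).
have slope x y : a <= x -> x <= y -> y <= b -> (y - x) * r ^- 2 <= dphi x - dphi y.
  move=> ax xy yb; have [|c cxy e] := @mean_value dphi ddphi x y xy.
    by move=> z /(sub _ _ _ ax yb); exact: d2.
  rewrite -[leRHS]opprB e -mulNr mulrC; apply: ler_wpM2r.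
    by rewrite subr_ge0.
  by rewrite lerNr; apply: dm; exact: sub cxy.
have pos x y : a <= x -> x <= y -> y <= b -> 0 <= dphi y ->
    `|\int[leb]_(z in `[x, y]) cos (phi z)| <= 3 * r.
  move=> ax xy yb dy.
  have [h|h] := leP (y - x) r; first by apply: (le_trans (triv _ _ _ _ _ _)) => //; lra.
  rewrite (@integral_split _ _ x (y - r) y); [|lra|lra|exact: int].
  apply: (le_trans (ler_normD _ _)).
  have -> : 3 * r = 2 / r^-1 + r by rewrite invrK; ring.
  apply: lerD; last by apply: triv => //; lra.
  apply: (@van_der_corput_first _ dphi ddphi) => //; first by lra.
  - by rewrite invr_gt0.
  - by move=> z hz; apply: d1; apply: sub hz; lra.
  - by move=> z hz; apply: d2; apply: sub hz; lra.
  - by move=> z hz; apply: cd; apply: sub hz; lra.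
  - move=> z /andP[xz zy]; have h1 : a <= z by lra.
    have h2 : z <= y by lra.
    have := slope _ _ h1 h2 yb; rewrite -rr.
    have : r * r ^- 2 <= (y - z) * r ^- 2 by apply: ler_wpM2r; [exact: ltW|lra].
    lra.
  - left=> z hz; apply: (@le_trans _ _ (- r ^- 2)); last by rewrite oppr_le0 ltW.
    by apply: dm; apply: sub hz; lra.
have neg x y : a <= x -> x <= y -> y <= b -> dphi x <= 0 ->
    `|\int[leb]_(z in `[x, y]) cos (phi z)| <= 3 * r.
  move=> ax xy yb dx.
  have [h|h] := leP (y - x) r; first by apply: (le_trans (triv _ _ _ _ _ _)) => //; lra.
  rewrite (@integral_split _ _ x (x + r) y); [|lra|lra|exact: int].
  apply: (le_trans (ler_normD _ _)).
  have -> : 3 * r = r + 2 / r^-1 by rewrite invrK; ring.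
  apply: lerD; first by apply: triv => //; lra.
  apply: (@van_der_corput_first_neg _ dphi ddphi) => //; first by lra.
  - by rewrite invr_gt0.
  - by move=> z hz; apply: d1; apply: sub hz; lra.
  - by move=> z hz; apply: d2; apply: sub hz; lra.
  - by move=> z hz; apply: cd; apply: sub hz; lra.
  - move=> z /andP[xz zy]; have h1 : x <= z by lra.
    have h2 : z <= b by lra.
    have := slope _ _ ax h1 h2; rewrite -rr.
    have : r * r ^- 2 <= (z - x) * r ^- 2 by apply: ler_wpM2r; [exact: ltW|lra].
    lra.
  - move=> z hz; apply: (@le_trans _ _ (- r ^- 2)); last by rewrite oppr_le0 ltW.
    by apply: dm; apply: sub hz; lra.
have [h|ha] := leP (dphi a) 0.
  by apply: (le_trans (neg _ _ _ _ _ _)) => //; lra.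
have [h|hb] := leP 0 (dphi b).
  by apply: (le_trans (pos _ _ _ _ _ _)) => //; lra.
have [||c] := @IVT _ dphi a b 0 ab.
- by apply: within_cont => z hz; exact: der_cont (d2 _ hz).
- by rewrite ge_min le_max (ltW ha) (ltW hb) orbT.
rewrite in_itv/= => /andP[ac cb] dc.
rewrite (@integral_split _ _ a c b)//; last exact: int.
apply: (le_trans (ler_normD _ _)).
have -> : 6 * r = 3 * r + 3 * r by ring.
by apply: lerD; [apply: pos|apply: neg] => //; rewrite dc.
Qed.

End VdC.

(** * Fourier integrals over one period *)

Section Period.
Local Open Scope classical_set_scope.
Context (R : realType).
Implicit Types (f g F : R -> R) (x a b c : R).
Local Notation leb := (@lebesgue_measure R).

Lemma der_shift c x : has_deriv x (fun y => c + y) 1.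
Proof. by apply: (der_eq (derD (der_cst _ _) (der_id _))); rewrite add0r. Qed.

Lemma der_reflect c x : has_deriv x (fun y => c - y) (- 1).
Proof. by apply: (der_eq (derD (der_cst _ _) (derN (der_id _)))); rewrite add0r. Qed.

Lemma integral_shift f a b c : a <= b -> continuous f ->
  \int[leb]_(x in `[a, b]) f (c + x) = \int[leb]_(x in `[c + a, c + b]) f x.
Proof.
move=> ab cf; have [F _ dF] := primitive_exists cf.
transitivity (F (c + b) - F (c + a)).
  apply: (@FTC _ _ (fun x => F (c + x))) => // x _.
    by apply: (der_eq (der_comp (f := fun y => c + y) (dF _) (der_shift c x))); rewrite mulr1.
  apply: (@continuous_comp _ _ _ (fun x => c + x) f); last exact: cf.
  exact: der_cont (der_shift c x).
by apply/esym/(FTC _ (fun x _ => dF x) (fun x _ => cf x)); rewrite lerD2l.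
Qed.

Lemma integral_reflect f a b c : a <= b -> continuous f ->
  \int[leb]_(x in `[a, b]) f (c - x) = \int[leb]_(x in `[c - b, c - a]) f x.
Proof.
move=> ab cf; have [F _ dF] := primitive_exists cf.
transitivity (F (c - a) - F (c - b)).
  transitivity (- F (c - b) - - F (c - a)); last by ring.
  apply: (@FTC _ _ (fun x => - F (c - x))) => // x _.
    apply: (der_eq (derN (der_comp (f := fun y => c - y) (dF _) (der_reflect c x)))).
    by rewrite mulrN1 opprK.
  apply: (@continuous_comp _ _ _ (fun x => c - x) f); last exact: cf.
  exact: der_cont (der_reflect c x).
by apply/esym/(FTC _ (fun x _ => dF x) (fun x _ => cf x)); rewrite lerD2l lerN2.
Qed.

(** The variable [u] is the distance to the point where [cos] vanishes and the phase
    degenerates, [s = sg ^ 2], and [e ^ 4] bounds the distance of [- nu] to the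
    degenerate value [2 s], measured relative to [2 s].  For [u <= e ^ 2]
    the first derivative stays bigger than [s e ^ 4]; for [u >= e ^ 2] the second one is
    bigger than [s e ^ 2]. *)
Lemma quarter_period_bound (nu gam sg e : R) : 0 < sg -> 0 < e <= 1 ->
  e ^+ 4 <= `|nu / (2 * sg ^+ 2) + 1| ->
  `|\int[leb]_(u in `[0, pi / 2]) cos (nu * u + 2 * sg ^+ 2 * sin u + gam)|
    <= 8 / (sg * e).
Proof.
move=> sg0 /andP[e0 e1] he.
pose phi u := nu * u + 2 * sg ^+ 2 * sin u + gam.
pose dphi u := nu + 2 * sg ^+ 2 * cos u.
pose ddphi u := - (2 * sg ^+ 2) * sin u.
have d1 (u : R) : has_deriv u phi (dphi u).
  by apply: der_eq; [rewrite /phi; der|rewrite /dphi; ring].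
have d2 (u : R) : has_deriv u dphi (ddphi u).
  by apply: der_eq; [rewrite /dphi; der|rewrite /ddphi; ring].
have cd (u : R) : {for u, continuous ddphi}.
  by apply: der_cont; rewrite /ddphi; der.
have int a b : leb.-integrable `[a, b] (EFin \o (fun u => cos (phi u))).
  by apply: cont_integrable => u _; apply: der_cont; apply: der_cos; exact: d1.
set p := e ^+ 2.
have p0 : 0 < p by rewrite exprn_gt0.
have p1 : p <= 1 by rewrite expr_le1// ltW.
have pi2 : 1 <= pi / 2 :> R := pihalf_ge1 R.
have s2 : 0 < sg ^+ 2 by rewrite exprn_gt0.
rewrite (@integral_split _ _ 0 p (pi / 2)); [|lra|lra|exact: int].
apply: (le_trans (ler_normD _ _)).
have -> : 8 / (sg * e) = 2 / (sg * e) + 6 * (sg * e)^-1.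
  by field; rewrite !gt_eqF.
have sinp u : p <= u <= pi / 2 -> p / 2 <= sin u.
  move=> /andP[pu upi]; apply: (@le_trans _ _ (sin p)).
    by apply: sin_ge_half; lra.
  have inI x : p <= x <= pi / 2 -> x \in `[- (pi / 2), pi / 2]%R.
    by move=> ?; rewrite in_itv/=; lra.
  rewrite leNgt ltr_sin; first by rewrite -leNgt.
    by apply: inI; rewrite pu.
  by apply: inI; rewrite lexx (le_trans pu).
apply: lerD; last first.
  apply: (@van_der_corput_second _ _ dphi ddphi) => //; first by lra.
    by rewrite invr_gt0 mulr_gt0.
  move=> u /sinp hs; rewrite exprVn invrK /ddphi mulNr lerN2.
  have -> : (sg * e) ^+ 2 = (2 * sg ^+ 2) * (p / 2) by rewrite /p; field.
  by apply: ler_wpM2l => //; lra.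
have small : `|\int[leb]_(u in `[0, p]) cos (phi u)| <= 2 / (sg ^+ 2 * e ^+ 4).
  have m0 : 0 < sg ^+ 2 * e ^+ 4 by rewrite mulr_gt0// exprn_gt0.
  have cos_lo u : 0 <= u <= p -> 1 - e ^+ 4 / 2 <= cos u.
    move=> /andP[u0 up]; have := cos_ge_quadratic u.
    have : u ^+ 2 <= p ^+ 2 by rewrite lerXn2r// ?nnegrE ltW.
    have -> : p ^+ 2 = e ^+ 4 by rewrite /p; ring.
    lra.
  have sin_pos u : 0 <= u <= p -> ddphi u <= 0.
    move=> /andP[u0 up]; rewrite /ddphi mulNr oppr_le0 mulr_ge0//; first by lra.
    by rewrite sin_ge0_pi//; lra.
  have E u : dphi u = (2 * sg ^+ 2) * ((nu / (2 * sg ^+ 2) + 1) - (1 - cos u)).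
    by rewrite /dphi; field; rewrite gt_eqF.
  have [h|h] := leP 0 (nu / (2 * sg ^+ 2) + 1).
    rewrite ger0_norm// in he.
    apply: (@van_der_corput_first _ _ dphi ddphi) => //; [lra| |by left].
    move=> u /cos_lo hc; rewrite E.
    have -> : sg ^+ 2 * e ^+ 4 = (2 * sg ^+ 2) * (e ^+ 4 - e ^+ 4 / 2) by field.
    by apply: ler_wpM2l; lra.
  rewrite ltr0_norm// in he.
  apply: (@van_der_corput_first_neg _ _ dphi ddphi) => //; first by lra.
  move=> u /cos_lo hc; rewrite E.
  have -> : - (sg ^+ 2 * e ^+ 4) = (2 * sg ^+ 2) * (- (e ^+ 4) + e ^+ 4 / 2) by field.
  apply: ler_wpM2l; first by lra.
  have e4 : 0 < e ^+ 4 by rewrite exprn_gt0.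
  by have := cos_le1 u; lra.
(* Below this threshold the length [e ^ 2] of the interval is the better bound, above
it [small] is; at the threshold both are of order [1 / (sg e)]. *)
have [h|h] := leP (sg * e ^+ 3) 2.
  apply: (@le_trans _ _ (1 * (p - 0))).
    by apply: (norm_integral_le (ltW p0) (int 0 p)) => u _; exact: cos_max.
  rewrite mul1r subr0 ler_pdivlMr ?mulr_gt0//.
  by have -> : p * (sg * e) = sg * e ^+ 3 by rewrite /p; ring.
apply: (le_trans small).
rewrite ler_pM2l// lef_pV2 ?posrE ?mulr_gt0// ?exprn_gt0//.
have -> : sg ^+ 2 * e ^+ 4 = sg * e * (sg * e ^+ 3) by ring.
by apply: ler_peMr; [rewrite mulr_ge0// ltW|lra].
Qed.

(** The period is cut at the zeros of the sine and the cosine into four quarters, each of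
    which is an instance of [quarter_period_bound] with [nu = n] or [nu = - n]. *)
Lemma period_bound_pos (n gam sg e : R) : 0 < sg -> 0 < e <= 1 ->
  e ^+ 4 <= `| `|n| / (2 * sg ^+ 2) - 1 | ->
  `|\int[leb]_(x in `[- pi, pi]) cos (n * x + sg ^+ 2 * (2 - 2 * cos x) + gam)|
    <= 32 / (sg * e).
Proof.
move=> sg0 e01 he.
have s2 : 0 < 2 * sg ^+ 2 by rewrite mulr_gt0// exprn_gt0.
have sep nu : `|nu| = `|n| -> e ^+ 4 <= `|nu / (2 * sg ^+ 2) + 1|.
  move=> nuE; apply: (le_trans he); rewrite -nuE.
  have -> : `|nu| / (2 * sg ^+ 2) = `|nu / (2 * sg ^+ 2)|.
    by rewrite normrM (@ger0_norm _ _^-1)// invr_ge0 ltW.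
  set q := nu / _.
  have [q0|q0] := leP 0 q.
    by rewrite (ger0_norm q0) (@ger0_norm _ (q + 1)) ?ler_norml; lra.
  by rewrite (ltr0_norm q0) -normrN opprD !opprK.
pose f x := cos (n * x + sg ^+ 2 * (2 - 2 * cos x) + gam).
have cf : continuous f.
  by move=> x; apply: der_cont; rewrite /f; der.
have int a b : leb.-integrable `[a, b] (EFin \o f).
  by apply: cont_integrable => x _; exact: cf.
have pi0 : 0 < pi :> R := pi_gt0 R.
have pi20 : 0 <= pi / 2 :> R by lra.
rewrite (@integral_split _ f (- pi) (- (pi / 2)) pi); [|lra|lra|exact: int].
rewrite (@integral_split _ f (- (pi / 2)) 0 pi); [|lra|lra|exact: int].
rewrite (@integral_split _ f 0 (pi / 2) pi); [|lra|lra|exact: int].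
pose cc := n * (pi / 2) + 2 * sg ^+ 2 + gam.
pose cc' := - n * (pi / 2) + 2 * sg ^+ 2 + gam.
have q1 : \int[leb]_(x in `[- pi, - (pi / 2)]) f x =
    \int[leb]_(u in `[0, pi / 2]) cos (- n * u + 2 * sg ^+ 2 * sin u + cc').
  have := integral_reflect (- (pi / 2)) pi20 cf.
  have -> : - (pi / 2) - pi / 2 = - pi :> R by lra.
  have -> : - (pi / 2) - 0 = - (pi / 2) :> R by lra.
  move=> <-; apply: eq_Rintegral => u _.
  rewrite /f /cc'; congr cos.
  have -> : cos (- (pi / 2) - u) = - sin u by rewrite -opprD cosN addrC cosDpihalf.
  by ring.
have q2 : \int[leb]_(x in `[- (pi / 2), 0]) f x =
    \int[leb]_(u in `[0, pi / 2]) cos (- n * u + 2 * sg ^+ 2 * sin u - cc').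
  have := integral_shift (- (pi / 2)) pi20 cf.
  have -> : - (pi / 2) + 0 = - (pi / 2) :> R by lra.
  have -> : - (pi / 2) + pi / 2 = 0 :> R by lra.
  move=> <-; apply: eq_Rintegral => u _.
  rewrite /f /cc' -cosN; congr cos.
  have -> : cos (- (pi / 2) + u) = sin u by rewrite addrC cosBpihalf.
  by ring.
have q3 : \int[leb]_(x in `[0, pi / 2]) f x =
    \int[leb]_(u in `[0, pi / 2]) cos (n * u + 2 * sg ^+ 2 * sin u - cc).
  have := integral_reflect (pi / 2) pi20 cf.
  have -> : pi / 2 - pi / 2 = 0 :> R by lra.
  have -> : pi / 2 - 0 = pi / 2 :> R by lra.
  move=> <-; apply: eq_Rintegral => u _.
  rewrite /f /cc -cosN; congr cos.
  have -> : cos (pi / 2 - u) = sin u by rewrite -opprB cosN cosBpihalf.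
  by ring.
have q4 : \int[leb]_(x in `[pi / 2, pi]) f x =
    \int[leb]_(u in `[0, pi / 2]) cos (n * u + 2 * sg ^+ 2 * sin u + cc).
  have := integral_shift (pi / 2) pi20 cf.
  have -> : pi / 2 + 0 = pi / 2 :> R by lra.
  have -> : pi / 2 + pi / 2 = pi :> R by lra.
  move=> <-; apply: eq_Rintegral => u _.
  rewrite /f /cc; congr cos.
  have -> : cos (pi / 2 + u) = - sin u by rewrite addrC cosDpihalf.
  by ring.
rewrite q1 q2 q3 q4.
have -> : 32 / (sg * e) = 8 / (sg * e) + (8 / (sg * e) + (8 / (sg * e) + 8 / (sg * e))).
  by case/andP: e01 => e0 _; field; rewrite !gt_eqF.
apply: (le_trans (ler_normD _ _)); apply: lerD.
  by apply: quarter_period_bound => //; apply: sep; rewrite normrN.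
apply: (le_trans (ler_normD _ _)); apply: lerD.
  by apply: quarter_period_bound => //; apply: sep; rewrite normrN.
by apply: (le_trans (ler_normD _ _)); apply: lerD;
  apply: quarter_period_bound => //; exact: sep.
Qed.

Lemma period_bound (n gam s sg e : R) : 0 < sg -> 0 < e <= 1 -> `|s| = sg ^+ 2 ->
  e ^+ 4 <= `| `|n| / (2 * sg ^+ 2) - 1 | ->
  `|\int[leb]_(x in `[- pi, pi]) cos (n * x + s * (2 - 2 * cos x) + gam)|
    <= 32 / (sg * e).
Proof.
move=> sg0 e01 hs he.
have [s0|s0] := leP 0 s.
  have -> : s = sg ^+ 2 by rewrite -hs ger0_norm.
  exact: period_bound_pos.
have -> : s = - sg ^+ 2 by rewrite -hs ltr0_norm// opprK.
under eq_Rintegral => x _.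
  rewrite -cosN (_ : - _ = - n * x + sg ^+ 2 * (2 - 2 * cos x) + - gam); last by ring.
  over.
by apply: period_bound_pos => //; rewrite normrN.
Qed.

End Period.

(** * Fresnel integrals *)

Section Fresnel.
Local Open Scope classical_set_scope.
Context (R : realType).
Implicit Types (f g F : R -> R) (x a b c : R).
Local Notation leb := (@lebesgue_measure R).

Lemma der_quad al x : has_deriv x (fun y => y ^+ 2 + al) (2 * x).
Proof. by apply: der_eq; [der|rewrite /=; ring]. Qed.

Lemma continuous_cos_quad al : continuous (fun y : R => cos (y ^+ 2 + al)).
Proof. by move=> x; apply: der_cont; apply: der_cos; exact: der_quad. Qed.

Definition fresnel (al : R) : R -> R :=
  s2val (primitive_exists (continuous_cos_quad (al := al))).

Lemma fresnel0 al : fresnel al 0 = 0.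
Proof. by rewrite /fresnel; case: primitive_exists. Qed.

Lemma der_fresnel al x : has_deriv x (fresnel al) (cos (x ^+ 2 + al)).
Proof. by rewrite /fresnel; case: primitive_exists. Qed.

Lemma eq_of_deriv f g (df : R -> R) : f 0 = g 0 ->
  (forall x, has_deriv x f (df x)) -> (forall x, has_deriv x g (df x)) ->
  f =1 g.
Proof.
move=> fg0 dff dg x.
have dh y : has_deriv y (fun y => f y - g y) 0.
  by apply: (der_eq (derD (dff y) (derN (dg y)))); rewrite subrr.
apply/eqP; rewrite -subr_eq0; apply/eqP.
have [x0|/ltW x0] := leP 0 x.
  have [c _] := mean_value x0 (fun y _ => dh y).
  by rewrite fg0 subrr subr0 mul0r.
have [c _] := mean_value x0 (fun y _ => dh y).
by rewrite fg0 subrr mul0r sub0r => /eqP; rewrite oppr_eq0 => /eqP.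
Qed.

Lemma fresnelN al x : fresnel al (- x) = - fresnel al x.
Proof.
suff /(_ x) : (fun x => - fresnel al (- x)) =1 fresnel al by move=> <-; rewrite opprK.
apply: eq_of_deriv => [|y|y]; last exact: der_fresnel.
  by rewrite /= oppr0 fresnel0 oppr0.
have dN : has_deriv y (fun y => - y) (- 1) by der.
apply: (der_eq (derN (der_comp (f := fun y => - y) (der_fresnel al _) dN))).
by rewrite mulrN1 opprK sqrrN.
Qed.

(** The integrals with the two phases [0] and [pi / 2] determine all the others. *)
Lemma fresnel_combine al x :
  fresnel al x = fresnel 0 x * cos al + fresnel (pi / 2) x * sin al.
Proof.
move: x; apply: eq_of_deriv => [|y|y].
- by rewrite !fresnel0; ring.
- exact: der_fresnel.
- have := derD (derM (der_fresnel 0 y) (der_cst y (cos al)))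
              (derM (der_fresnel (pi / 2) y) (der_cst y (sin al))).
  move=> /der_eq; apply; rewrite addr0 cosDpihalf cosD; ring.
Qed.

(** [van_der_corput_first] with [phi' = 2 v >= 2 x]. *)
Lemma fresnel_cauchy al x y : 0 < x -> x <= y ->
  `|fresnel al y - fresnel al x| <= x^-1.
Proof.
move=> x0 xy.
rewrite -(FTC xy (fun z _ => der_fresnel al z)); last first.
  by move=> z _; exact: continuous_cos_quad.
have -> : x^-1 = 2 / (2 * x) by field; rewrite gt_eqF.
apply: (@van_der_corput_first _ _ (fun z => 2 * z) (fun=> 2)) => //.
- by rewrite mulr_gt0.
- by move=> z _; exact: der_quad.
- by move=> z _; apply: der_eq; [der|ring].
- by move=> z _; exact: cst_continuous.
- by move=> z /andP[xz _]; rewrite ler_pM2l.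
- by right=> z _; exact: ler0n.
Qed.

(** The oscillation bound says that every value at [x], minus [1 / x], lies below every
    value at [y], plus [1 / y]; the supremum of the former numbers is the limit, with
    an explicit rate. *)
Lemma fresnel_limit_exists al :
  {l : R | forall x, 0 < x -> `|fresnel al x - l| <= x^-1}.
Proof.
pose A := [set fresnel al x - x^-1 | x in [set x | 0 < x]].
have key x y : 0 < x -> 0 < y -> fresnel al x - x^-1 <= fresnel al y + y^-1.
  move=> x0 y0.
  have ix : 0 < x^-1 by rewrite invr_gt0.
  have iy : 0 < y^-1 by rewrite invr_gt0.
  have [xy|/ltW yx] := leP x y.
    by have := fresnel_cauchy al x0 xy; rewrite ler_norml; lra.
  by have := fresnel_cauchy al y0 yx; rewrite ler_norml; lra.
have ubA y : 0 < y -> ubound A (fresnel al y + y^-1).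
  by move=> y0 _ [x x0 <-]; exact: key.
have A0 : A !=set0 by exists (fresnel al 1 - 1^-1); exists 1 => //=; exact: ltr01.
exists (sup A) => x x0.
have h1 : fresnel al x - x^-1 <= sup A.
  apply: ub_le_sup; last by exists x.
  by exists (fresnel al 1 + 1^-1); apply: ubA; exact: ltr01.
have h2 : sup A <= fresnel al x + x^-1.
  by apply: ge_sup => //; exact: ubA.
by rewrite ler_norml; lra.
Qed.

Definition fresnel_cos : R := sval (fresnel_limit_exists 0).
Definition fresnel_sin : R := sval (fresnel_limit_exists (pi / 2)).

(** The integral of [cos (v ^ 2 + al)] over the half-line [v > 0]. *)
Definition kappa al : R := fresnel_cos * cos al + fresnel_sin * sin al.

Lemma fresnel_kappa al x : 0 < x -> `|fresnel al x - kappa al| <= 2 / x.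
Proof.
move=> x0; rewrite fresnel_combine /kappa.
have h1 := svalP (fresnel_limit_exists 0) _ x0.
have h2 := svalP (fresnel_limit_exists (pi / 2)) _ x0.
rewrite -/fresnel_cos -/fresnel_sin in h1 h2.
have -> : fresnel 0 x * cos al + fresnel (pi / 2) x * sin al -
    (fresnel_cos * cos al + fresnel_sin * sin al) =
    (fresnel 0 x - fresnel_cos) * cos al + (fresnel (pi / 2) x - fresnel_sin) * sin al.
  by ring.
apply: (le_trans (ler_normD _ _)); rewrite !normrM.
have -> : 2 / x = x^-1 * 1 + x^-1 * 1 by ring.
by apply: lerD; apply: ler_pM => //; [exact: cos_max|exact: sin_max].
Qed.

(** [kappa] rotates with [al], so its values at [th] and [th - pi / 2] determine the
    sine of [th]. *)
Lemma kappa_sin th :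
  (fresnel_cos ^+ 2 + fresnel_sin ^+ 2) * sin th =
  fresnel_cos * kappa (th - pi / 2) + fresnel_sin * kappa th.
Proof. by rewrite /kappa cosBpihalf sinBpihalf; ring. Qed.

(** The integral up to [6/5] exceeds [0.95] because [cos (v ^ 2) >= 1 - v ^ 4 / 2], and
    the rest is at most [5/6]. *)
Lemma fresnel_cos_gt0 : 0 < fresnel_cos.
Proof.
(* At [6/5] the lower bound [x - x ^ 5 / 10] exceeds [1 / x]. *)
have u0 : 0 <= 6 / 5 :> R by lra.
have dd (y : R) : has_deriv y (fun y => fresnel 0 y - (y - y ^+ 5 / 10))
    (cos (y ^+ 2 + 0) - (1 - y ^+ 4 / 2)).
  apply: der_eq; first by apply: derD; [exact: der_fresnel|der].
  by rewrite /=; field.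
have [c _] := mean_value u0 (fun y _ => dd y).
rewrite fresnel0 addr0 => E.
have : 0 <= (cos (c ^+ 2) - (1 - c ^+ 4 / 2)) * (6 / 5 - 0).
  apply: mulr_ge0; last by lra.
  have := cos_ge_quadratic (c ^+ 2); rewrite -exprM; lra.
rewrite -E.
have h : 0 < 6 / 5 :> R by lra.
have := svalP (fresnel_limit_exists 0) _ h; rewrite -/fresnel_cos ler_norml.
rewrite expr0n/= mul0r => /andP[h1 h2] h3.
have e1 : (6 / 5 : R)^-1 = 5 / 6 by field.
have e2 : (6 / 5 : R) ^+ 5 = 7776 / 3125 by field.
rewrite e1 in h1 h2; rewrite e2 in h3; lra.
Qed.

Lemma norm_kappa_le al : `|kappa al| <= `|fresnel_cos| + `|fresnel_sin|.
Proof.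
rewrite /kappa; apply: (le_trans (ler_normD _ _)); rewrite !normrM.
by apply: lerD; rewrite ler_piMr// ?cos_max ?sin_max.
Qed.

Definition fresnel_bound : R := `|fresnel_cos| + `|fresnel_sin| + 2.

Lemma norm_fresnel_le al x : `|fresnel al x| <= fresnel_bound.
Proof.
wlog x0 : x / 0 <= x.
  move=> H; have [|/ltW x0] := leP 0 x; first exact: H.
  by rewrite -normrN -fresnelN; apply: H; rewrite oppr_ge0.
have n1 := normr_ge0 fresnel_cos; have n2 := normr_ge0 fresnel_sin.
have [x1|/ltW x1] := leP x 1.
  have [c _] := mean_value x0 (fun y _ => der_fresnel al y).
  rewrite fresnel0 !subr0 => ->; rewrite normrM (ger0_norm x0).
  apply: (@le_trans _ _ (1 * 1)); first by apply: ler_pM => //; exact: cos_max.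
  by rewrite /fresnel_bound; lra.
have x0' : 0 < x by exact: lt_le_trans x1.
have := fresnel_kappa al x0'; have := norm_kappa_le al.
have : 2 / x <= 2 by rewrite ler_pdivrMr// ler_peMr.
have := ler_normD (fresnel al x - kappa al) (kappa al); rewrite subrK.
by rewrite /fresnel_bound; lra.
Qed.

(** * The Cauchy-Schlomilch identity *)

(** The squares of the arguments, plus the phases, both equal
    [rt ^ 2 * phase (om ^ 2) tau + al], and the derivatives of the arguments add up to
    [2 rt om]: this is a primitive of the subordination integrand. *)
Definition schlomilch (rt al om tau : R) : R :=
  fresnel (al + rt ^+ 2 * om) (rt * (tau * om - (2 * tau)^-1)) +
  fresnel (al - rt ^+ 2 * om) (rt * (tau * om + (2 * tau)^-1)).

(** The phase of the integral that writes a function of [omega] as a superposition of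
    the functions [exp (i s omega ^ 2)], here with [s = t * tau ^ 2]. *)
Definition phase (lam tau : R) : R := (4 * tau ^+ 2)^-1 + lam * tau ^+ 2.

Definition dphase (lam tau : R) : R := - (2 * tau ^+ 3)^-1 + 2 * lam * tau.

Lemma der_phase lam tau : tau != 0 -> has_deriv tau (phase lam) (dphase lam tau).
Proof.
move=> t0; apply: der_eq.
  apply: derD; first by apply: derV; [rewrite mulf_neq0 ?expf_neq0|der].
  by der.
by rewrite /dphase /=; field.
Qed.

Lemma der_schlomilch rt al om tau : tau != 0 ->
  has_deriv tau (schlomilch rt al om)
    (2 * rt * om * cos (rt ^+ 2 * phase (om ^+ 2) tau + al)).
Proof.
move=> t0.
have dV : has_deriv tau (fun y => (2 * y)^-1) (- (2 * tau ^+ 2)^-1).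
  apply: der_eq; first by apply: derV; [rewrite mulf_neq0|der].
  by field.
have d1 : has_deriv tau (fun y => rt * (y * om - (2 * y)^-1))
    (rt * (om + (2 * tau ^+ 2)^-1)).
  apply: der_eq; first by apply: derM; [der|apply: derD; [der|apply: derN; exact: dV]].
  by rewrite /=; field.
have d2 : has_deriv tau (fun y => rt * (y * om + (2 * y)^-1))
    (rt * (om - (2 * tau ^+ 2)^-1)).
  apply: der_eq; first by apply: derM; [der|apply: derD; [der|exact: dV]].
  by rewrite /=; field.
apply: (der_eq (derD (der_comp (der_fresnel _ _) d1) (der_comp (der_fresnel _ _) d2))).
rewrite /=.
have -> : (rt * (tau * om - (2 * tau)^-1)) ^+ 2 + (al + rt ^+ 2 * om) =
  rt ^+ 2 * phase (om ^+ 2) tau + al by rewrite /phase; field.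
have -> : (rt * (tau * om + (2 * tau)^-1)) ^+ 2 + (al - rt ^+ 2 * om) =
  rt ^+ 2 * phase (om ^+ 2) tau + al by rewrite /phase; field.
by ring.
Qed.

Lemma continuous_cos_phase (s lam al : R) tau : tau != 0 ->
  {for tau, continuous (fun y => cos (s * phase lam y + al))}.
Proof.
move=> t0; apply: der_cont; apply: der_cos; apply: derD; last exact: der_cst.
by apply: derM; [exact: der_cst|exact: der_phase].
Qed.

Lemma schlomilch_integral (rt al om a b : R) : 0 < a -> a <= b ->
  2 * rt * om * \int[leb]_(x in `[a, b]) cos (rt ^+ 2 * phase (om ^+ 2) x + al) =
  schlomilch rt al om b - schlomilch rt al om a.
Proof.
move=> a0 ab.
have n0 x : a <= x <= b -> x != 0.
  by move=> /andP[ax _]; rewrite gt_eqF// (lt_le_trans a0).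
have ci x : a <= x <= b ->
    {for x, continuous (fun y => cos (rt ^+ 2 * phase (om ^+ 2) y + al))}.
  by move=> /n0; exact: continuous_cos_phase.
rewrite -RintegralZl//; last exact: cont_integrable.
apply: FTC => // x h; first exact/der_schlomilch/n0.
by apply: continuousM; [exact: cst_continuous|exact: ci].
Qed.

Lemma fresnel_cvg al (u : nat -> R) : u n @[n --> \oo] --> +oo ->
  fresnel al (u n) @[n --> \oo] --> kappa al.
Proof.
move=> uoo; apply/cvgrPdist_le => e e0.
near=> n; rewrite distrC.
have un : 2 / e <= u n by near: n; move: uoo => /cvgryPge; exact.
have un0 : 0 < u n by apply: lt_le_trans un; rewrite divr_gt0.
apply: (le_trans (fresnel_kappa _ un0)).
by rewrite ler_pdivrMr// mulrC -ler_pdivrMr.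
Unshelve. all: by end_near. Qed.

Lemma cvgr_ge_linear (u : nat -> R) c d : 0 < c ->
  (forall n, c * n.+1%:R - d <= u n) -> u n @[n --> \oo] --> +oo.
Proof.
move=> c0 cu; apply/cvgryPge => A; near=> n.
apply: le_trans (cu n); rewrite lerBrDr mulrC -ler_pdivrMr//.
have h : (A + d) / c <= n%:R by near: n; exact: nbhs_infty_ger.
by apply: (le_trans h); rewrite ler_nat.
Unshelve. all: by end_near. Qed.

(** As [tau] tends to infinity both arguments tend to [+oo]; as [tau] tends to [0] one
    tends to [-oo] and the other to [+oo].  The two limits with phase
    [al - rt ^ 2 om] cancel, the two others add. *)
Lemma schlomilch_cvg (rt al om : R) : 0 < rt -> 0 < om ->
  (schlomilch rt al om n.+1%:R - schlomilch rt al om n.+1%:R^-1) @[n --> \oo]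
    --> 2 * kappa (al + rt ^+ 2 * om).
Proof.
move=> rt0 om0.
pose um n : R := rt * (n.+1%:R * om - (2 * n.+1%:R)^-1).
pose up n : R := rt * (n.+1%:R * om + (2 * n.+1%:R)^-1).
pose vm n : R := rt * (n.+1%:R / 2 - n.+1%:R^-1 * om).
pose vp n : R := rt * (n.+1%:R^-1 * om + n.+1%:R / 2).
have n1 n : 1 <= n.+1%:R :> R by rewrite ler1n.
have n0 n : 0 < n.+1%:R :> R by [].
have i0 n : 0 < n.+1%:R^-1 :> R by rewrite invr_gt0.
have i1 n : n.+1%:R^-1 <= 1 :> R by rewrite invf_le1.
have ro0 : 0 < rt * om by rewrite mulr_gt0.
have umoo : um n @[n --> \oo] --> +oo.
  apply: (@cvgr_ge_linear _ (rt * om) rt) => // n.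
  rewrite /um invfM mulrBr [X in _ <= X - _](_ : _ = rt * om * n.+1%:R); last by ring.
  rewrite lerD2l lerN2; apply: ler_piMr; first exact: ltW.
  by move: (i0 n) (i1 n); move: (n.+1%:R^-1) => i; lra.
have upoo : up n @[n --> \oo] --> +oo.
  apply: (@cvgr_ge_linear _ (rt * om) 0) => // n.
  rewrite /up invfM mulrDr [X in _ <= X + _](_ : _ = rt * om * n.+1%:R); last by ring.
  by rewrite subr0 lerDl mulr_ge0// ?(ltW rt0)// mulr_ge0// ltW.
have vmoo : vm n @[n --> \oo] --> +oo.
  apply: (@cvgr_ge_linear _ (rt / 2) (rt * om)); first by rewrite divr_gt0.
  move=> n; rewrite /vm mulrBr [X in _ <= X - _](_ : _ = rt / 2 * n.+1%:R); last by field.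
  by rewrite lerD2l lerN2 ler_pM2l// ler_piMl// ltW.
have vpoo : vp n @[n --> \oo] --> +oo.
  apply: (@cvgr_ge_linear _ (rt / 2) 0); first by rewrite divr_gt0.
  move=> n; rewrite /vp mulrDr [leRHS]addrC [X in _ <= X + _](_ : _ = rt / 2 * n.+1%:R); last by field.
  by rewrite subr0 lerDl !mulr_ge0// ltW.
set th := al + rt ^+ 2 * om.
set th' := al - rt ^+ 2 * om.
have -> : 2 * kappa th = (kappa th + kappa th') - (- kappa th + kappa th') by ring.
have -> : (fun n => schlomilch rt al om n.+1%:R - schlomilch rt al om n.+1%:R^-1) =
    (fun n => (fresnel th (um n) + fresnel th' (up n)) -
              (- fresnel th (vm n) + fresnel th' (vp n))).
  apply/funext => n; rewrite /schlomilch -/th -/th' -fresnelN.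
  congr (_ - (fresnel _ _ + fresnel _ _)).
    by rewrite /vm; field; rewrite gt_eqF.
  by rewrite /vp; field; rewrite gt_eqF.
apply: cvgB; apply: cvgD; try exact: fresnel_cvg.
by apply: cvgN; exact: fresnel_cvg.
Qed.

End Fresnel.

(** * The nonstationary part of the subordination integral *)

Section Nonstationary.
Local Open Scope classical_set_scope.
Context (R : realType).
Implicit Types (x a b c lam tau t : R).
Local Notation leb := (@lebesgue_measure R).

(** Vanishes to second order at [1 / 4], so that two integrations by parts leave no
    boundary term there, and is [1 + O (tau ^ 4)] at [0], which makes the complementary
    factor [high_cut] small enough near [0]. *)
Definition cutoff tau : R := (1 - 256 * tau ^+ 4) ^+ 2.
Let k : R := 256.
Let cutoff1 tau : R := - (8 * k * tau ^+ 3) * (1 - k * tau ^+ 4).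
Let cutoff2 tau : R :=
  - (24 * k * tau ^+ 2) * (1 - k * tau ^+ 4) + 32 * k ^+ 2 * tau ^+ 6.

Lemma der_cutoff tau : has_deriv tau cutoff (cutoff1 tau).
Proof.
rewrite /cutoff /cutoff1 -/k; move: k => k'.
by apply: der_eq; [der|rewrite /=; ring].
Qed.

Lemma der_cutoff1 tau : has_deriv tau cutoff1 (cutoff2 tau).
Proof.
rewrite /cutoff1 /cutoff2; move: k => k'.
by apply: der_eq; [der|rewrite /=; ring].
Qed.

Let den lam tau : R := 1 - 4 * lam * tau ^+ 4.
Let h0 lam tau : R := - (2 * tau ^+ 3) * (den lam tau)^-1.
Let num lam tau : R := - (6 * tau ^+ 2) - 8 * lam * tau ^+ 6.
Let num1 lam tau : R := - (12 * tau) - 48 * lam * tau ^+ 5.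
Let h1 lam tau : R := num lam tau * (den lam tau)^-1 ^+ 2.
Let h2 lam tau : R := num1 lam tau * (den lam tau)^-1 ^+ 2 +
  32 * lam * tau ^+ 3 * num lam tau * (den lam tau)^-1 ^+ 3.

Lemma der_den lam tau : has_deriv tau (den lam) (- (16 * lam * tau ^+ 3)).
Proof. by apply: der_eq; [der|rewrite /=; ring]. Qed.

Lemma der_denV lam tau : den lam tau != 0 -> has_deriv tau (fun x => (den lam x)^-1)
  (16 * lam * tau ^+ 3 * (den lam tau)^-1 ^+ 2).
Proof.
move=> d0; apply: der_eq; first by apply: derV; [exact: d0|exact: der_den].
by move: (den lam tau) d0 => d d0; field.
Qed.

Lemma der_h0 lam tau : den lam tau != 0 -> has_deriv tau (h0 lam) (h1 lam tau).
Proof.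
move=> d0; apply: der_eq; first by apply: derM; [der|exact: der_denV].
by move: d0; rewrite /h1 /num /den /= => d0; field.
Qed.

Lemma der_h1 lam tau : den lam tau != 0 -> has_deriv tau (h1 lam) (h2 lam tau).
Proof.
move=> d0; apply: der_eq.
  by apply: derM; [rewrite /num; der|apply: derX; exact: der_denV].
by rewrite /h2 /num1 /=; ring.
Qed.

Let g0 lam tau := cutoff tau * h0 lam tau.
Let g1 lam tau := cutoff1 tau * h0 lam tau + cutoff tau * h1 lam tau.
Let g2 lam tau := cutoff2 tau * h0 lam tau + cutoff1 tau * h1 lam tau +
  (cutoff1 tau * h1 lam tau + cutoff tau * h2 lam tau).
Let rest lam tau := g2 lam tau * h0 lam tau + g1 lam tau * h1 lam tau.

Lemma der_g0 lam tau : den lam tau != 0 -> has_deriv tau (g0 lam) (g1 lam tau).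
Proof.
move=> d0; apply: der_eq; first by apply: derM; [exact: der_cutoff|exact: der_h0].
by rewrite /g1; ring.
Qed.

Lemma der_g1 lam tau : den lam tau != 0 -> has_deriv tau (g1 lam) (g2 lam tau).
Proof.
move=> d0; apply: der_eq.
  by apply: derD; apply: derM;
    [exact: der_cutoff1|exact: der_h0|exact: der_cutoff|exact: der_h1].
by rewrite /g2; ring.
Qed.

Lemma continuous_rest lam tau : den lam tau != 0 -> {for tau, continuous (rest lam)}.
Proof.
move=> d0; apply: der_cont; apply: derD; apply: derM.
- apply: derD; first apply: derD.
  + by apply: derM; [rewrite /cutoff2; der|exact: der_h0].
  + by apply: derM; [exact: der_cutoff1|exact: der_h1].
  + apply: derD; apply: derM; [exact: der_cutoff1|exact: der_h1|exact: der_cutoff|].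
    apply: derD.
      by apply: derM; [rewrite /num1; der|apply: derX; exact: der_denV].
    apply: derM; last by apply: derX; exact: der_denV.
    by apply: derM; [der|rewrite /num; der].
- exact: der_h0.
- exact: der_g1.
- exact: der_h1.
Qed.

Lemma h0_dphase lam tau : tau != 0 -> den lam tau != 0 ->
  h0 lam tau * dphase lam tau = 1.
Proof.
move=> t0 d0; rewrite /h0 /dphase; move: d0; rewrite /den => d0.
by field; rewrite t0 d0.
Qed.

(** Two integrations by parts at once: [bd] is the resulting boundary term, and
    [rest] is the cutoff after two applications of the adjoint of the
    operator [h0 d/dtau], which multiplies the exponential of [i t phase] by [i t] because
    [h0] is the inverse of the derivative of the phase. *)
Lemma cutoff_integral lam t al a b : 0 < a -> a <= b -> 0 < t ->
  (forall x, a <= x <= b -> den lam x != 0) ->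
  let theta x := t * phase lam x + al in
  let bd x := t^-1 * g0 lam x * sin (theta x) +
              t ^- 2 * (g1 lam x * h0 lam x) * cos (theta x) in
  \int[leb]_(x in `[a, b]) (cutoff x * cos (theta x)) =
  bd b - bd a - t ^- 2 * \int[leb]_(x in `[a, b]) (rest lam x * cos (theta x)).
Proof.
move=> a0 ab t0 dn theta bd.
have n0 x : a <= x <= b -> x != 0.
  by move=> /andP[ax _]; rewrite gt_eqF// (lt_le_trans a0).
have dth x : a <= x <= b -> has_deriv x theta (t * dphase lam x).
  move=> h; apply: der_eq; first apply: derD.
  - by apply: derM; [exact: der_cst|exact/der_phase/n0].
  - exact: der_cst.
  - by rewrite mulr0 !addr0.
have c1 x : a <= x <= b -> {for x, continuous (fun x => cutoff x * cos (theta x))}.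
  move=> h; apply: der_cont.
  by apply: derM; [exact: der_cutoff|apply: der_cos; exact: dth].
have c2 x : a <= x <= b -> {for x, continuous (fun x => rest lam x * cos (theta x))}.
  move=> h; apply: continuousM; first exact/continuous_rest/dn.
  by apply: der_cont; apply: der_cos; exact: dth.
have c3 x : a <= x <= b ->
    {for x, continuous (fun x => t ^- 2 * (rest lam x * cos (theta x)))}.
  by move=> h; apply: continuousM; [exact: cst_continuous|exact: c2].
apply/eqP; rewrite eq_sym subr_eq eq_sym; apply/eqP.
rewrite -RintegralZl//; last exact: cont_integrable.
rewrite -RintegralD//; [|exact: cont_integrable..].
apply: (@FTC _ _ bd _ _ ab); last first.
  by move=> x h; apply: continuousD; [exact: c1|exact: c3].
move=> x h; apply: der_eq.
  apply: derD; apply: derM.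
  - by apply: derM; [exact: der_cst|exact/der_g0/dn].
  - by apply: der_sin; exact: dth.
  - apply: derM; first exact: der_cst.
    by apply: derM; [exact/der_g1/dn|exact/der_h0/dn].
  - by apply: der_cos; exact: dth.
have e := h0_dphase (n0 _ h) (dn _ h).
rewrite /=.
transitivity (cutoff x * (h0 lam x * dphase lam x) * cos (theta x) +
  t^-1 * g1 lam x * (1 - h0 lam x * dphase lam x) * sin (theta x) +
  t ^- 2 * (rest lam x * cos (theta x))).
  by rewrite /rest /g0; field; rewrite gt_eqF.
by rewrite e; ring.
Qed.

Section Bounds.
Variables (lam tau : R).
Hypotheses (l0 : 0 <= lam) (l16 : lam <= 16) (t0 : 0 < tau) (t4 : tau <= 1 / 4).

Let pw n : 0 <= tau ^+ n <= 1.
Proof.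
have t1 : tau <= 1 by have := t4; lra.
by rewrite (exprn_ge0 n (ltW t0)) (exprn_ile1 n (ltW t0) t1).
Qed.

Lemma den_ge : 1 / 2 <= den lam tau.
Proof.
have : tau ^+ 4 <= (1 / 4) ^+ 4.
  by rewrite lerXn2r// nnegrE; have := t0; have := t4; lra.
have -> : (1 / 4 : R) ^+ 4 = 1 / 256 by field.
have := pw 4; have := l0; have := l16; rewrite /den; nra.
Qed.

Let iv := (den lam tau)^-1.
Let iv0 : 0 < iv. Proof. by rewrite invr_gt0 (lt_le_trans _ den_ge)//; lra. Qed.
Let iv2 : iv <= 2.
Proof.
have d0 : 0 < den lam tau by rewrite (lt_le_trans _ den_ge)//; lra.
rewrite /iv -[leRHS]invrK lef_pV2 ?posrE ?invr_gt0//.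
by have := den_ge; lra.
Qed.

Let normM_le (x y a b : R) : `|x| <= a -> `|y| <= b -> `|x * y| <= a * b.
Proof. by move=> xa yb; rewrite normrM; apply: ler_pM. Qed.

Let normD_le (x y a b : R) : `|x| <= a -> `|y| <= b -> `|x + y| <= a + b.
Proof. by move=> xa yb; apply: (le_trans (ler_normD _ _)); exact: lerD. Qed.

Let norm_pw n : `|tau ^+ n| <= 1.
Proof. by case/andP: (pw n) => p0 p1; rewrite ger0_norm. Qed.

Let norm_iv n : `|iv ^+ n| <= 2 ^+ n.
Proof. by rewrite ger0_norm ?exprn_ge0 ?(ltW iv0)// lerXn2r// ?nnegrE// ltW. Qed.

Let norm_lam : `|lam| <= 16. Proof. by rewrite ger0_norm. Qed.

Let norm_cst (c : R) : 0 <= c -> `|c| <= c. Proof. by move=> c0; rewrite ger0_norm. Qed.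

Let k0 : 0 <= k. Proof. exact: ler0n. Qed.

Let norm_u : `|1 - k * tau ^+ 4| <= 1.
Proof.
have : tau ^+ 4 <= (1 / 4) ^+ 4.
  by rewrite lerXn2r// nnegrE; have := t0; have := t4; lra.
have -> : (1 / 4 : R) ^+ 4 = 1 / 256 by field.
by case/andP: (pw 4) => ? ? ?; rewrite ler_norml /k; lra.
Qed.

(** A generous common bound for the cutoff, for [h0] and for their first two
    derivatives on the segment. *)
Definition ibp_bound : R := 1000 * 1000 * 1000.
Local Notation M := ibp_bound.

Let bc0 : `|cutoff tau| <= M.
Proof.
apply: (@le_trans _ _ 1); last by rewrite /M; lra.
by rewrite /cutoff normrX exprn_ile1.
Qed.

Let bc1 : `|cutoff1 tau| <= M.
Proof.
apply: (le_trans (normM_le (a := 8 * k * 1) _ norm_u)); last by rewrite /M /k; lra.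
by rewrite normrN; do 2 apply: normM_le => //; apply: norm_cst.
Qed.

Let bc2 : `|cutoff2 tau| <= M.
Proof.
apply: (@le_trans _ _ (24 * k * 1 * 1 + 32 * k ^+ 2 * 1)); last first.
  by rewrite /M /k expr2; lra.
apply: normD_le; apply: normM_le => //.
  by rewrite normrN; do 2 apply: normM_le => //; apply: norm_cst.
by apply: normM_le; apply: norm_cst => //; exact: sqr_ge0.
Qed.

Let bh0 : `|h0 lam tau| <= M * tau.
Proof.
apply: (@le_trans _ _ (2 * tau * 2)); last by rewrite /M; have := t0; nra.
rewrite /h0 -/iv; apply: normM_le; last by have := norm_iv 1.
rewrite normrN; apply: normM_le; first exact: norm_cst.
rewrite exprS -[leRHS]mulr1; apply: normM_le => //.
by rewrite ger0_norm// ltW.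
Qed.

Let bnum : `|num lam tau| <= 134.
Proof.
apply: (@le_trans _ _ (6 * 1 + 8 * 16 * 1)); last by lra.
apply: normD_le; rewrite normrN; apply: normM_le => //.
  exact: norm_cst.
by apply: normM_le => //; exact: norm_cst.
Qed.

Let bh1 : `|h1 lam tau| <= M.
Proof.
apply: (le_trans (normM_le bnum (norm_iv 2))).
by rewrite /M expr2; lra.
Qed.

Let bnum1 : `|num1 lam tau| <= 780.
Proof.
apply: (@le_trans _ _ (12 * 1 + 48 * 16 * 1)); last by lra.
apply: normD_le; rewrite normrN; apply: normM_le => //.
- exact: norm_cst.
- by have := norm_pw 1.
- by apply: normM_le => //; exact: norm_cst.
Qed.

Let bh2 : `|h2 lam tau| <= M.
Proof.
apply: (@le_trans _ _ (780 * 2 ^+ 2 + 32 * 16 * 1 * 134 * 2 ^+ 3)); last first.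
  by rewrite /M !exprS expr0; lra.
apply: normD_le; apply: normM_le; [exact: bnum1|exact: norm_iv| |exact: norm_iv].
apply: normM_le; last exact: bnum.
by do 2 apply: normM_le => //; exact: norm_cst.
Qed.

Lemma g0_bound : `|g0 lam tau| <= M ^+ 2 * tau.
Proof. by rewrite expr2 -mulrA; exact: normM_le. Qed.

Let bh0' : `|h0 lam tau| <= M.
Proof.
apply: (le_trans bh0); rewrite ler_piMr//; first by rewrite /M; lra.
by have := t4; lra.
Qed.

Lemma g1_h0_bound : `|g1 lam tau * h0 lam tau| <= 2 * M ^+ 3.
Proof.
have -> : 2 * M ^+ 3 = (M * M + M * M) * M by ring.
by apply: normM_le => //; apply: normD_le; exact: normM_le.
Qed.

Lemma rest_bound : `|rest lam tau| <= 6 * M ^+ 3.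
Proof.
have -> : 6 * M ^+ 3 = ((M * M + M * M) + (M * M + M * M)) * M + (M * M + M * M) * M.
  by ring.
apply: normD_le; apply: normM_le => //; apply: normD_le.
- by apply: normD_le; exact: normM_le.
- by apply: normD_le; exact: normM_le.
- exact: normM_le.
- exact: normM_le.
Qed.

End Bounds.

(** On this segment [1 - 4 lam tau ^ 4 >= 3/4], so the phase has no stationary
    point.  The condition [t * a <= 1] makes the boundary term at [a], which is of order
    [a / t], as small as the main contribution. *)
Lemma cutoff_integral_bound lam t al a : 0 <= lam <= 16 -> 1 <= t -> 0 < a ->
  a <= 1 / 4 -> t * a <= 1 ->
  `|\int[leb]_(x in `[a, 1 / 4]) (cutoff x * cos (t * phase lam x + al))| <=
  10 * ibp_bound ^+ 3 / t ^+ 2.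
Proof.
move=> /andP[l0 l16] t1 a0 a4 ta.
set M := ibp_bound.
have M1 : 1 <= M by rewrite /M /ibp_bound; lra.
have t0 : 0 < t by lra.
have dn x : a <= x <= 1 / 4 -> den lam x != 0.
  move=> /andP[ax x4]; have x0 : 0 < x by lra.
  by rewrite gt_eqF// (lt_le_trans _ (den_ge l0 l16 x0 x4))//; lra.
rewrite (cutoff_integral al a0 a4 t0 dn).
have q4 : (1 / 4 : R) ^+ 4 = 1 / 256 by field.
have -> : g0 lam (1 / 4) = 0.
  by rewrite /g0 /cutoff q4 (_ : 1 - _ = 0) ?expr0n/= ?mul0r//; field.
have -> : g1 lam (1 / 4) = 0.
  rewrite /g1 /cutoff /cutoff1 q4 /k (_ : 1 - _ = 0); last by field.
  by rewrite expr0n/= mulr0 !mul0r addr0.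
rewrite mulr0 !mul0r mulr0 mul0r addr0 sub0r.
have it2 : 0 < t ^- 2 by rewrite invr_gt0 exprn_gt0.
have it : 0 < t^-1 by rewrite invr_gt0.
have tt : t^-1 = t * t ^- 2 by field; rewrite gt_eqF.
have -> : 10 * M ^+ 3 / t ^+ 2 =
   (t ^- 2 * M ^+ 2 * 1 + t ^- 2 * (2 * M ^+ 3) * 1 + t ^- 2 * (6 * M ^+ 3 * 1)) +
   t ^- 2 * (2 * M ^+ 3 - M ^+ 2) by field; rewrite gt_eqF.
apply: (@le_trans _ _
  (t ^- 2 * M ^+ 2 * 1 + t ^- 2 * (2 * M ^+ 3) * 1 + t ^- 2 * (6 * M ^+ 3 * 1))); last first.
  rewrite lerDl; apply: mulr_ge0; first exact: ltW.
  rewrite subr_ge0.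
  have : M ^+ 2 <= M ^+ 3 by rewrite ler_weXn2l.
  have : 0 <= M ^+ 2 by rewrite sqr_ge0.
  move: (M ^+ 3) (M ^+ 2) => m3 m2; lra.
apply: (le_trans (ler_normD _ _)); rewrite !normrN; apply: lerD.
  apply: (le_trans (ler_normD _ _)); apply: lerD.
    rewrite normrM; apply: ler_pM => //; last exact: sin_max.
    rewrite normrM (gtr0_norm it).
    apply: (@le_trans _ _ (t^-1 * (M ^+ 2 * a))).
      by rewrite ler_pM2l//; exact: g0_bound.
    rewrite tt mulrC; have -> : M ^+ 2 * a * (t * t ^- 2) = (t * a) * (t ^- 2 * M ^+ 2) by ring.
    by rewrite ler_piMl// mulr_ge0 ?sqr_ge0 ?(ltW it2).
  rewrite normrM; apply: ler_pM => //; last exact: cos_max.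
  rewrite normrM (gtr0_norm it2) ler_pM2l//; exact: g1_h0_bound.
rewrite normrM (gtr0_norm it2) ler_pM2l//.
apply: (@le_trans _ _ (6 * M ^+ 3 * (1 / 4 - a))).
  apply: norm_integral_le => //.
    apply: cont_integrable => x h; apply: continuousM; first exact/continuous_rest/dn.
    apply: continuous_cos_phase; case/andP: h => ax _.
    by rewrite gt_eqF// (lt_le_trans a0).
  move=> x /andP[ax x4]; have x0 : 0 < x by lra.
  rewrite normrM -[leRHS]mulr1; apply: ler_pM => //; last exact: cos_max.
  exact: rest_bound.
rewrite ler_wpM2l//; last by lra.
by rewrite mulr_ge0// exprn_ge0//; lra.
Qed.

End Nonstationary.

(** * Fourth powers of the period integrals *)

Section PeriodNorm.
Local Open Scope classical_set_scope.
Context (R : realType).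
Implicit Types (x a b c n s tau t r : R).
Local Notation leb := (@lebesgue_measure R).

Definition period_phase n s x : R := n * x + s * (2 - 2 * cos x).

Lemma der_period_phase n s x : has_deriv x (period_phase n s) (n + 2 * s * sin x).
Proof. by apply: der_eq; [der|rewrite /=; ring]. Qed.

(** Bounds the integral over a period for all shifts of the phase at once. *)
Definition period_norm n s : R :=
  `|\int[leb]_(x in `[- pi, pi]) cos (period_phase n s x)| +
  `|\int[leb]_(x in `[- pi, pi]) sin (period_phase n s x)|.

Lemma cos_period_integrable n s :
  leb.-integrable `[- pi, pi] (EFin \o (fun x => cos (period_phase n s x))).
Proof.
by apply: cont_integrable => x _; apply: der_cont; apply: der_cos; exact: der_period_phase.
Qed.

Lemma sin_period_integrable n s :
  leb.-integrable `[- pi, pi] (EFin \o (fun x => sin (period_phase n s x))).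
Proof.
by apply: cont_integrable => x _; apply: der_cont; apply: der_sin; exact: der_period_phase.
Qed.

Lemma period_norm_le n s M :
  (forall gam, `|\int[leb]_(x in `[- pi, pi]) cos (period_phase n s x + gam)| <= M) ->
  period_norm n s <= 2 * M.
Proof.
move=> H; have -> : 2 * M = M + M by ring.
apply: lerD.
  by have := H 0; under eq_Rintegral do rewrite addr0.
by have := H (- (pi / 2)); under eq_Rintegral do rewrite cosBpihalf.
Qed.

Lemma period_norm_ge0 n s : 0 <= period_norm n s.
Proof. exact: addr_ge0. Qed.

Lemma period_norm_trivial n s : period_norm n s <= 64.
Proof.
have -> : 64 = 2 * 32 :> R by ring.
apply: period_norm_le => gam.
have pi2 : pi / 2 < 2 :> R := pihalf_lt2 R.
have pi0 : 0 < pi :> R := pi_gt0 R.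
apply: (@le_trans _ _ (1 * (pi - - pi))); last by lra.
apply: norm_integral_le; first by lra.
  apply: cont_integrable => x _; apply: der_cont; apply: der_cos.
  by apply: derD; [exact: der_period_phase|exact: der_cst].
by move=> *; exact: cos_max.
Qed.

Lemma period_norm_bound n s sg e : 0 < sg -> 0 < e <= 1 -> `|s| = sg ^+ 2 ->
  e ^+ 4 <= `| `|n| / (2 * sg ^+ 2) - 1 | -> period_norm n s <= 64 / (sg * e).
Proof.
move=> sg0 e01 hs he; have -> : 64 / (sg * e) = 2 * (32 / (sg * e)) by ring.
by apply: period_norm_le => gam; exact: period_bound.
Qed.

Definition high_cut tau : R := if tau <= 1 / 4 then 1 - cutoff tau else 1.

Lemma high_cut_ge0 tau : 0 <= tau -> 0 <= high_cut tau.
Proof.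
move=> t0; rewrite /high_cut; case: ifPn => // t4; rewrite subr_ge0 /cutoff.
have : tau ^+ 4 <= (1 / 4) ^+ 4 by rewrite lerXn2r// nnegrE; lra.
have -> : (1 / 4 : R) ^+ 4 = 1 / 256 by field.
have := exprn_ge0 4 t0; move: (tau ^+ 4) => u u0 u1.
by rewrite exprn_ile1; lra.
Qed.

Lemma high_cut_le1 tau : high_cut tau <= 1.
Proof.
rewrite /high_cut; case: ifPn => // _.
by rewrite lerBlDr lerDl /cutoff sqr_ge0.
Qed.

Lemma high_cut_le tau : high_cut tau <= 512 * tau ^+ 4.
Proof.
have t40 : 0 <= tau ^+ 4 by rewrite exprn_even_ge0.
rewrite /high_cut; case: ifPn => [_|]; rewrite /cutoff.
  have := sqr_ge0 (256 * tau ^+ 4).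
  have -> : 512 * tau ^+ 4 = 1 - (1 - 256 * tau ^+ 4) ^+ 2 + (256 * tau ^+ 4) ^+ 2 by ring.
  by rewrite lerDl.
rewrite -ltNge => t4.
have : (1 / 4) ^+ 4 <= tau ^+ 4 by rewrite lerXn2r// ?nnegrE; lra.
have -> : (1 / 4 : R) ^+ 4 = 1 / 256 by field.
lra.
Qed.

(** The pole of the bound for the fourth power, regularised at the scale [eps] at which
    the trivial bound takes over. *)
Definition log_kernel r eps x : R := (`|x - r| + eps)^-1.

(** The first summand controls large [tau]; the second one, restricted to a
    neighbourhood of the transition point [r], has an integral of size
    [log (1 / eps)]. *)
Definition majorant r eps : R -> R :=
  fun x => 2 * (1 + x ^+ 2)^-1 + (log_kernel r eps \_ `[r - 1, r + 1]) x.

(** [r] is the value of [tau] at which [|n| = 2 s], and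
    [||n| / (2 s) - 1| = |r - tau| (r + tau) / tau ^ 2 >= d / tau]. *)
Lemma period_norm4_separated n t tau d r s :
  0 < t -> 0 < tau -> 0 <= r -> r ^+ 2 = `|n| / (2 * t) ->
  d = `|tau - r| -> 0 < d -> `|s| = t * tau ^+ 2 ->
  period_norm n s ^+ 4 <= 64 ^+ 4 * (t ^- 2 * tau ^- 4 * (1 + tau / d)).
Proof.
move=> t0 tau0 r0 rE dE d0 sE.
(* [e ^ 4 = eta] must be at most [1] in [period_norm_bound]; this costs only the
summand [1] in [1 + tau / d]. *)
pose eta : R := Num.min 1 (d / tau).
have eta0 : 0 < eta by rewrite lt_min ltr01 divr_gt0.
have eta1 : eta <= 1 by rewrite ge_min lexx.
pose e := Num.sqrt (Num.sqrt eta).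
have e4 : e ^+ 4 = eta.
  by rewrite (exprM e 2 2) sqr_sqrtr ?sqrtr_ge0// sqr_sqrtr// ltW.
have e0 : 0 < e by rewrite !sqrtr_gt0.
have e1 : e <= 1 by rewrite -(@expr_le1 _ 4) ?(ltW e0)// e4.
pose sg := Num.sqrt t * tau.
have sg2 : sg ^+ 2 = t * tau ^+ 2 by rewrite exprMn sqr_sqrtr// ltW.
have sg0 : 0 < sg by rewrite mulr_gt0// sqrtr_gt0.
have dist : e ^+ 4 <= `| `|n| / (2 * sg ^+ 2) - 1 |.
  rewrite e4 sg2.
  have -> : `|n| / (2 * (t * tau ^+ 2)) - 1 = (r - tau) * ((r + tau) / tau ^+ 2).
    transitivity (r ^+ 2 / tau ^+ 2 - 1); last by field; rewrite gt_eqF.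
    by rewrite rE; field; rewrite !gt_eqF.
  rewrite normrM distrC -dE ger0_norm; last first.
    by rewrite divr_ge0 ?sqr_ge0// addr_ge0// ltW.
  apply: (@le_trans _ _ (d / tau)); first by rewrite ge_min lexx orbT.
  rewrite ler_pM2l//.
  have -> : tau^-1 = tau / tau ^+ 2 by field; rewrite gt_eqF.
  by rewrite ler_pM2r ?invr_gt0 ?exprn_gt0// lerDr.
have h : period_norm n s <= 64 / (sg * e).
  by apply: period_norm_bound => //; rewrite ?e0 ?e1// sE sg2.
apply: (@le_trans _ _ ((64 / (sg * e)) ^+ 4)).
  rewrite lerXn2r// ?nnegrE; first exact: period_norm_ge0.
  by rewrite divr_ge0// mulr_ge0// ltW.
have -> : (64 / (sg * e)) ^+ 4 = 64 ^+ 4 * (t ^- 2 * tau ^- 4 * eta^-1).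
  rewrite -e4.
  rewrite expr_div_n exprMn (exprM sg 2 2) sg2.
  by field; rewrite !gt_eqF.
rewrite ler_pM2l ?exprn_gt0// ler_pM2l; last first.
  by rewrite mulr_gt0// invr_gt0 exprn_gt0.
rewrite /eta; have [h1|h1] := leP 1 (d / tau).
  by rewrite invr1 lerDl divr_ge0// ltW.
by rewrite invf_div lerDr.
Qed.

(** Within distance [t ^ -2] of the transition point only the trivial bound is used;
    there the kernel is already of order [t ^ 2].  Farther away
    [period_norm4_separated] applies, and the factor [high_cut], of order [tau ^ 4] at
    [0] and bounded at infinity, compensates [tau ^ -4] for small [tau] and
    leaves [tau ^ -2] for large [tau]. *)
Lemma period_norm4_majorant n t tau s : 1 <= t -> 0 < tau -> `|s| = t * tau ^+ 2 ->
  high_cut tau * period_norm n s ^+ 4 <=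
  (2048 * 64 ^+ 4) * (t ^- 2 * majorant (Num.sqrt (`|n| / (2 * t))) (t ^- 2) tau).
Proof.
move=> t1 tau0 sE.
have t0 : 0 < t by lra.
set r := Num.sqrt _.
have r0 : 0 <= r by exact: sqrtr_ge0.
have rE : r ^+ 2 = `|n| / (2 * t).
  by rewrite sqr_sqrtr// divr_ge0// mulr_ge0// ltW.
set d := `|tau - r|.
set eps := t ^- 2.
have eps0 : 0 < eps by rewrite invr_gt0 exprn_gt0.
have eps1 : eps <= 1 by rewrite invf_le1 ?exprn_gt0// exprn_ege1.
pose q : R := (1 + tau ^+ 2)^-1.
have q0 : 0 < q by rewrite invr_gt0 ltr_pwDl// sqr_ge0.
have [B BE] : exists B : R, B = 64 ^+ 4 by exists (64 ^+ 4).
have B0 : 0 < B by rewrite BE exprn_gt0.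
rewrite -BE.
have c0 : 0 <= high_cut tau by rewrite high_cut_ge0// ltW.
have in_itv1 : d <= 1 -> (log_kernel r eps \_ `[r - 1, r + 1]) tau = (d + eps)^-1.
  move=> d1; rewrite patchE mem_set//= in_itv/=.
  by move: d1; rewrite ler_norml; lra.
have ker0 : 0 <= (log_kernel r eps \_ `[r - 1, r + 1]) tau.
  by apply: restrict_ge0 => x _; rewrite invr_ge0 addr_ge0// ltW.
(* Near the transition point the kernel is at least [1 / (2 eps)]. *)
have [dle|dgt] := leP d eps.
  have d1 : d <= 1 by lra.
  have d0 : 0 <= d by exact: normr_ge0.
  apply: (@le_trans _ _ (1 * B)).
    apply: ler_pM => //; [by rewrite exprn_ge0// period_norm_ge0|exact: high_cut_le1|].
    by rewrite BE lerXn2r ?nnegrE ?period_norm_ge0// period_norm_trivial.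
  rewrite mul1r -[leLHS]mulr1 [2048 * _]mulrC -mulrA ler_pM2l//.
  rewrite /majorant in_itv1//.
  have : 1 / 2 <= eps * (d + eps)^-1.
    by rewrite ler_pdivlMr; lra.
  have : 0 <= eps * (2 * q) by rewrite mulr_ge0 ?mulr_ge0 ?ltW.
  by rewrite -/q mulrDr; lra.
have d0 : 0 < d by lra.
have di0 : 0 < d^-1 by rewrite invr_gt0.
have h4 := @period_norm4_separated n t tau d r s t0 tau0 r0 rE erefl d0 sE.
rewrite -BE in h4.
have cut_w : high_cut tau * (tau ^- 4 * (1 + tau / d)) <= 1024 * q * (1 + d^-1).
  have tn : tau != 0 by rewrite gt_eqF.
  have p2 : 0 < 1 + tau ^+ 2 by rewrite ltr_pwDl// sqr_ge0.
  have [h|h] := leP tau 1.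
    apply: (@le_trans _ _ (512 * tau ^+ 4 * (tau ^- 4 * (1 + tau / d)))).
      apply: ler_wpM2r; last exact: high_cut_le.
      by rewrite mulr_ge0 ?invr_ge0 ?exprn_ge0 ?addr_ge0 ?divr_ge0// ltW.
    have -> : 512 * tau ^+ 4 * (tau ^- 4 * (1 + tau / d)) = 512 * (1 + tau / d).
      by field; rewrite tn gt_eqF.
    have qh : 1 / 2 <= q.
      have : tau ^+ 2 <= 1 by rewrite expr_le1// ltW.
      by rewrite /q div1r lef_pV2 ?posrE//; lra.
    apply: (@le_trans _ _ (1024 * (1 / 2) * (1 + d^-1))).
      have -> : 1024 * (1 / 2) = 512 :> R by field.
      apply: ler_wpM2l; first exact: ler0n.
      rewrite lerD2l; apply: ler_piMl => //; exact: ltW.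
    apply: ler_wpM2r; first by apply: addr_ge0 => //; exact: ltW.
    by apply: ler_wpM2l; [exact: ler0n|exact: qh].
  apply: (@le_trans _ _ (1 * (tau ^- 4 * (1 + tau / d)))).
    apply: ler_wpM2r; last exact: high_cut_le1.
    by rewrite mulr_ge0 ?invr_ge0 ?exprn_ge0 ?addr_ge0 ?divr_ge0// ltW.
  rewrite mul1r.
  apply: (@le_trans _ _ (tau ^- 4 * (tau * (1 + d^-1)))).
    rewrite ler_pM2l ?invr_gt0 ?exprn_gt0// mulrDr mulr1 lerD2r; exact: ltW.
  rewrite mulrA ler_pM2r ?addr_gt0//.
  have -> : tau ^- 4 * tau = tau ^- 3 by field.
  apply: (@le_trans _ _ (tau ^- 2)).
    rewrite lef_pV2 ?posrE ?exprn_gt0//; apply: ler_weXn2l => //; exact: ltW.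
  rewrite -[1024 * q]/(1024 / (1 + tau ^+ 2)) ler_pdivlMr//.
  have -> : tau ^- 2 * (1 + tau ^+ 2) = tau ^- 2 + 1 by field.
  have : tau ^- 2 <= 1 by rewrite invf_le1 ?exprn_gt0// exprn_ege1// ltW.
  lra.
apply: (@le_trans _ _ (B * (eps * (1024 * q * (1 + d^-1))))).
  apply: (@le_trans _ _ (high_cut tau * (B * (eps * tau ^- 4 * (1 + tau / d))))).
    exact: ler_wpM2l.
  rewrite mulrCA ler_pM2l// -mulrA mulrCA ler_pM2l//.
have -> : 2048 * B = B * 2048 :> R by ring.
rewrite -[leRHS]mulrA ler_pM2l// [leRHS]mulrCA ler_pM2l// /majorant -/q.
have q1 : q <= 1 by rewrite invf_le1 ?lerDl ?sqr_ge0// ltr_pwDl// sqr_ge0.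
have [h|h] := leP d 1.
  rewrite in_itv1//.
  have : d^-1 <= 2 * (d + eps)^-1.
    have -> : 2 * (d + eps)^-1 = ((d + eps) / 2)^-1 by field; rewrite gt_eqF; lra.
    by rewrite lef_pV2 ?posrE; lra.
  have : q * d^-1 <= 1 * d^-1 by rewrite ler_pM2r.
  by rewrite mulrDr mulr1; nra.
have : d^-1 <= 1 by rewrite invf_le1// ltW.
nra.
Qed.

Lemma majorant_integral r eps a b : 0 < eps -> a <= b ->
  leb.-integrable `[a, b] (EFin \o majorant r eps) /\
  \int[leb]_(x in `[a, b]) majorant r eps x <= 2 * pi + 2 * ln (1 + eps^-1).
Proof.
move=> eps0 ab.
have ck : continuous (log_kernel r eps).
  move=> x; apply: (@continuousV _ _ (fun x => `|x - r| + eps)); first by rewrite gt_eqF// ltr_wpDl.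
  apply: continuousD; last exact: cst_continuous.
  apply: (@continuous_comp _ _ _ (fun x => x - r) Num.norm); last exact: norm_continuous.
  by apply: der_cont; der.
have ik u v : leb.-integrable `[u, v] (EFin \o log_kernel r eps).
  by apply: cont_integrable => x _; exact: ck.
have k0 x : 0 <= log_kernel r eps x by rewrite invr_ge0 addr_ge0// ltW.
have p2 x : 0 < 1 + x ^+ 2 by rewrite ltr_pwDl// sqr_ge0.
have cq x : a <= x <= b -> {for x, continuous (fun x => 2 * (1 + x ^+ 2)^-1)}.
  move=> _; apply: der_cont; apply: derM; first exact: der_cst.
  by apply: derV; [rewrite gt_eqF|der].
have iq : leb.-integrable `[a, b] (EFin \o (fun x => 2 * (1 + x ^+ 2)^-1)).
  exact: cont_integrable.
have il : leb.-integrable `[a, b] (EFin \o (log_kernel r eps \_ `[r - 1, r + 1])).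
  rewrite -restrict_EFin; apply/integrable_restrict => //.
  by apply: integrableS (ik a b) => //; exact: measurableI.
split.
  by have := integrableD _ iq il; exact.
rewrite RintegralD//; apply: lerD.
  have E : \int[leb]_(x in `[a, b]) (2 * (1 + x ^+ 2)^-1) = 2 * atan b - 2 * atan a.
    apply: (@FTC _ _ (fun x => 2 * atan x) _ _ ab) => // x _.
    apply: der_eq; first by apply: derM; [der|apply: der_atan; der].
    by rewrite /=; ring.
  rewrite E.
  by have := atan_ltpi2 b; have := atan_gtNpi2 a; lra.
rewrite -Rintegral_mkcondr.
apply: (@le_trans _ _ (\int[leb]_(x in `[r - 1, r + 1]) log_kernel r eps x)).
  rewrite /Rintegral; apply: fine_le.
  - apply: integrable_fin_num; first exact: measurableI.
    by apply: integrableS (ik a b) => //; exact: measurableI.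
  - by apply: integrable_fin_num => //; exact: ik.
  - apply: ge0_subset_integral => //; first exact: measurableI.
      by apply/measurable_EFinP; exact: measurable_funTS (continuous_measurable_fun ck).
    by move=> x _; rewrite lee_fin.
rewrite (@integral_split _ _ (r - 1) r (r + 1)); [|lra|lra|exact: ik].
have E1 : \int[leb]_(x in `[r, r + 1]) log_kernel r eps x = ln (1 + eps) - ln eps.
  transitivity (\int[leb]_(x in `[r, r + 1]) (x - r + eps)^-1).
    apply: eq_Rintegral => x; rewrite inE/= in_itv/= => /andP[rx _].
    by rewrite /log_kernel ger0_norm// subr_ge0.
  transitivity (ln (r + 1 - r + eps) - ln (r - r + eps)).
    apply: (@FTC _ _ (fun x => ln (x - r + eps))); first by lra.
      move=> x /andP[rx _]; apply: der_eq; first by apply: der_ln; [lra|der].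
      by rewrite /=; ring.
    move=> x /andP[rx _]; apply: der_cont; apply: derV; [lra|der].
  by congr (ln _ - ln _); ring.
have E2 : \int[leb]_(x in `[r - 1, r]) log_kernel r eps x = ln (1 + eps) - ln eps.
  transitivity (\int[leb]_(x in `[r - 1, r]) (r - x + eps)^-1).
    apply: eq_Rintegral => x; rewrite inE/= in_itv/= => /andP[_ xr].
    by rewrite /log_kernel distrC ger0_norm// subr_ge0.
  transitivity (- ln (r - r + eps) - - ln (r - (r - 1) + eps)).
    apply: (@FTC _ _ (fun x => - ln (r - x + eps))); first by lra.
      move=> x /andP[_ xr]; apply: der_eq; first by apply: derN; apply: der_ln; [lra|der].
      by rewrite /=; ring.
    move=> x /andP[_ xr]; apply: der_cont; apply: derV; [lra|der].
  by rewrite opprK addrC; congr (ln _ - ln _); ring.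
rewrite E1 E2.
have -> : 1 + eps^-1 = (1 + eps) / eps by field; rewrite gt_eqF.
rewrite ln_div ?posrE//; first by lra.
by lra.
Qed.

End PeriodNorm.

(** * Fubini's theorem for bounded functions *)

Section SigmaFiniteProduct.
Local Open Scope classical_set_scope.
Context d1 d2 (T1 : measurableType d1) (T2 : measurableType d2) (R : realType).
Context (m1 : {sigma_finite_measure set T1 -> \bar R}).
Context (m2 : {sigma_finite_measure set T2 -> \bar R}).

(** A name of its own for the product measure, to which the structure of a
    sigma-finite measure is attached; repeated products can then be formed. *)
Definition sigma_product : set (T1 * T2) -> \bar R := (m1 \x m2)%E.

HB.instance Definition _ := Measure.on sigma_product.

Lemma sigma_product_sigma_finite : sigma_finite setT sigma_product.
Proof.
have /sigma_finiteP[F [TF ndF Ffin]] := sigma_finiteT m1.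
have /sigma_finiteP[G [TG ndG Gfin]] := sigma_finiteT m2.
exists (fun n => F n `*` G n); last first.
  move=> n; have [mFn Fnoo] := Ffin n; have [mGn Gnoo] := Gfin n.
  split; first exact: measurableX.
  rewrite /sigma_product product_measure1E// -ge0_fin_numE ?mule_ge0//.
  by rewrite fin_numM// ge0_fin_numE.
apply/seteqP; split=> // -[x y] _.
have [i _ Fix] : (\bigcup_i F i) x by rewrite -TF.
have [j _ Gjy] : (\bigcup_i G i) y by rewrite -TG.
exists (maxn i j) => //; split => /=.
  by have /subsetPset := ndF _ _ (leq_maxl i j); exact.
by have /subsetPset := ndG _ _ (leq_maxr i j); exact.
Qed.

HB.instance Definition _ := Measure_isSigmaFinite.Build _ _ _ sigma_product
  sigma_product_sigma_finite.

End SigmaFiniteProduct.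

Section FubiniSets.
Local Open Scope classical_set_scope.
Context d1 d2 (T1 : measurableType d1) (T2 : measurableType d2) (R : realType).
Context (m1 : {sigma_finite_measure set T1 -> \bar R}).
Context (m2 : {sigma_finite_measure set T2 -> \bar R}).
Implicit Types (F : T1 * T2 -> R) (A : set T1) (B : set T2).
Local Notation m12 := (m1 \x m2)%E.

Lemma restrict_setX F A B x y :
  ((EFin \o F) \_ (A `*` B)) (x, y) =
  ((fun x => ((fun y => (F (x, y))%:E) \_ B) y) \_ A) x.
Proof.
rewrite !patchE; have [xA|xA] := boolP (x \in A).
  have [yB|yB] := boolP (y \in B).
    by rewrite mem_set// ; split; exact: set_mem.
  by rewrite memNset// => -[_ /mem_set]; rewrite (negbTE yB).
by rewrite memNset// => -[/mem_set]; rewrite (negbTE xA).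
Qed.

Lemma fubini_set12 F A B : measurable A -> measurable B ->
  m12.-integrable (A `*` B) (EFin \o F) ->
  (\int[m12]_(z in A `*` B) (F z)%:E =
   \int[m1]_(x in A) \int[m2]_(y in B) (F (x, y))%:E)%E.
Proof.
move=> mA mB iF.
rewrite integral_mkcond -integral12_prod_meas1; last first.
  by have := iF; rewrite integrable_mkcond; last exact: measurableX.
rewrite [RHS]integral_mkcond; apply: eq_integral => x _.
rewrite /fubini_F; under eq_integral do rewrite restrict_setX.
rewrite patchE; case: ifPn => xA.
  by rewrite [RHS]integral_mkcond; apply: eq_integral => y _; rewrite patchE xA.
by apply: integral0_eq => y _; rewrite patchE (negbTE xA).
Qed.

Lemma fubini_set21 F A B : measurable A -> measurable B ->
  m12.-integrable (A `*` B) (EFin \o F) ->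
  (\int[m12]_(z in A `*` B) (F z)%:E =
   \int[m2]_(y in B) \int[m1]_(x in A) (F (x, y))%:E)%E.
Proof.
move=> mA mB iF.
rewrite integral_mkcond -integral21_prod_meas1; last first.
  by have := iF; rewrite integrable_mkcond; last exact: measurableX.
rewrite [RHS]integral_mkcond; apply: eq_integral => y _.
rewrite /fubini_G; under eq_integral do rewrite restrict_setX.
rewrite patchE; case: ifPn => yB.
  by rewrite [RHS]integral_mkcond; apply: eq_integral => x _; rewrite !patchE yB.
apply: integral0_eq => x _; rewrite !patchE (negbTE yB).
by case: ifP.
Qed.

End FubiniSets.

Section Bounded.
Local Open Scope classical_set_scope.

Lemma integrable_of_bound d (T : measurableType d) (R : realType)
    (mu : {measure set T -> \bar R}) (f : T -> R) (A : set T) M :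
  measurable A -> (mu A < +oo)%E -> measurable_fun setT f ->
  (forall x, A x -> `|f x| <= M) -> mu.-integrable A (EFin \o f).
Proof.
move=> mA muA mf fM; apply: measurable_bounded_integrable => //.
  exact: measurable_funTS.
exists M; split; first exact: num_real.
by move=> r Mr x Ax; apply: (le_trans (fM _ Ax)); exact: ltW.
Qed.

Lemma integrable_scale d (T : measurableType d) (R : realType)
    (mu : {measure set T -> \bar R}) (f : T -> R) (A : set T) k :
  measurable A -> mu.-integrable A (EFin \o f) ->
  mu.-integrable A (EFin \o (fun x => k * f x)).
Proof.
move=> mA fi; have := integrableZl mA k fi.
by apply: eq_integrable => // x _ /=; rewrite EFinM.
Qed.

Lemma norm_Rintegral_le d (T : measurableType d) (R : realType)
    (mu : {measure set T -> \bar R}) (f : T -> R) (A : set T) M :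
  measurable A -> (mu A < +oo)%E -> mu.-integrable A (EFin \o f) ->
  (forall x, A x -> `|f x| <= M) ->
  `|\int[mu]_(x in A) f x| <= M * fine (mu A).
Proof.
move=> mA muA fi fM; apply: (le_trans (le_normr_Rintegral mA fi)).
rewrite -Rintegral_cst//; apply: le_Rintegral => //.
  by have := integrable_norm fi.
by apply: (@integrable_of_bound _ _ _ _ _ _ `|M|).
Qed.

Context d1 d2 (T1 : measurableType d1) (T2 : measurableType d2) (R : realType).
Context (m1 : {sigma_finite_measure set T1 -> \bar R}).
Context (m2 : {sigma_finite_measure set T2 -> \bar R}).
Implicit Types (F : T1 * T2 -> R) (A : set T1) (B : set T2).
Local Notation m12 := (m1 \x m2)%E.

Lemma prod_measure_finite A B : measurable A -> measurable B ->
  (m1 A < +oo)%E -> (m2 B < +oo)%E -> (m12 (A `*` B) < +oo)%E.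
Proof.
move=> mA mB fA fB; rewrite product_measure1E// -ge0_fin_numE ?mule_ge0//.
by rewrite fin_numM// ge0_fin_numE.
Qed.

Variables (F : T1 * T2 -> R) (A : set T1) (B : set T2) (M : R).
Hypotheses (mA : measurable A) (mB : measurable B).
Hypotheses (fA : (m1 A < +oo)%E) (fB : (m2 B < +oo)%E).
Hypotheses (mF : measurable_fun setT F) (FM : forall x y, A x -> B y -> `|F (x, y)| <= M).

Lemma integrable_slice1 x : A x -> m2.-integrable B (EFin \o (fun y => F (x, y))).
Proof.
move=> Ax; apply: (@integrable_of_bound _ _ _ _ _ _ M) => //.
  by apply: measurableT_comp => //; exact: pair1_measurable.
by move=> y By; exact: FM.
Qed.

Lemma integrable_slice2 y : B y -> m1.-integrable A (EFin \o (fun x => F (x, y))).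
Proof.
move=> By; apply: (@integrable_of_bound _ _ _ _ _ _ M) => //.
  by apply: measurableT_comp => //; exact: pair2_measurable.
by move=> x Ax; exact: FM.
Qed.

Lemma integrable_bounded_prod : m12.-integrable (A `*` B) (EFin \o F).
Proof.
apply: (@integrable_of_bound _ _ _ _ _ _ M) => //.
- exact: measurableX.
- exact: prod_measure_finite.
- by case=> x y [/= Ax By]; exact: FM.
Qed.

Lemma fubini_bounded12 :
  \int[m12]_(z in A `*` B) F z = \int[m1]_(x in A) \int[m2]_(y in B) F (x, y).
Proof.
rewrite /Rintegral fubini_set12//; last exact: integrable_bounded_prod.
congr fine; apply: eq_integral => x /set_mem Ax.
by rewrite fineK//; apply: integrable_fin_num => //; exact: integrable_slice1.
Qed.

Lemma fubini_bounded21 :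
  \int[m12]_(z in A `*` B) F z = \int[m2]_(y in B) \int[m1]_(x in A) F (x, y).
Proof.
rewrite /Rintegral fubini_set21//; last exact: integrable_bounded_prod.
congr fine; apply: eq_integral => y /set_mem By.
by rewrite fineK//; apply: integrable_fin_num => //; exact: integrable_slice2.
Qed.

Let restricted_integrable : m12.-integrable setT ((EFin \o F) \_ (A `*` B)).
Proof.
by have := integrable_bounded_prod; rewrite integrable_mkcond; last exact: measurableX.
Qed.

Lemma integrable_inner1 :
  m1.-integrable A (EFin \o (fun x => \int[m2]_(y in B) F (x, y))).
Proof.
have := integrableS measurableT mA (@subsetT _ A) (integrable_fubini_F restricted_integrable).
apply: eq_integrable => // x xA; rewrite /fubini_F /=.
under eq_integral do rewrite restrict_setX.
rewrite fineK; last first.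
  by apply: integrable_fin_num => //; apply: integrable_slice1; exact: set_mem.
by rewrite [RHS]integral_mkcond; apply: eq_integral => y _; rewrite patchE xA.
Qed.

Lemma integrable_inner2 :
  m2.-integrable B (EFin \o (fun y => \int[m1]_(x in A) F (x, y))).
Proof.
have mG : measurable_fun B (EFin \o (fun y => \int[m1]_(x in A) F (x, y))).
  apply: eq_measurable_fun (measurable_funTS (measurable_fubini_G restricted_integrable)).
  move=> y yB; rewrite /fubini_G /=.
  under eq_integral do rewrite restrict_setX.
  rewrite fineK; last first.
    by apply: integrable_fin_num => //; apply: integrable_slice2; exact: set_mem.
  by rewrite [RHS]integral_mkcond; apply: eq_integral => x _; rewrite !patchE yB.
apply: measurable_bounded_integrable => //; first exact/measurable_EFinP.
exists (M * fine (m1 A)); split; first exact: num_real.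
move=> r Mr y By; apply: le_trans (ltW Mr).
by apply: norm_Rintegral_le => //; [exact: integrable_slice2|move=> x Ax; exact: FM].
Qed.

End Bounded.

Section PhaseProduct.
Local Open Scope classical_set_scope.
Context d1 (T1 : measurableType d1) (R : realType).
Context (m1 : {sigma_finite_measure set T1 -> \bar R}).
Local Notation leb := (@lebesgue_measure R).
Local Notation m12 := (m1 \x leb)%E.

(** Expanding the cosine of a sum splits the integral over the product into products of
    integrals over the factors; the hypothesis for all shifts [gam] covers the sine as
    well as the cosine, so the conclusion has the same form and can be
    iterated. *)
Lemma phase_product_bound (A : set T1) (u : T1 -> R) (v : R -> R) (P : R)
    (b : set (measurableTypeR R)) :
  measurable A -> (m1 A < +oo)%E -> measurable_fun setT u ->
  measurable b -> (leb b < +oo)%E -> measurable_fun setT (v : measurableTypeR R -> R) ->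
  (forall gam, `|\int[m1]_(x in A) cos (u x + gam)| <= P) ->
  forall gam,
  `|\int[m12]_(z in A `*` b) cos (u z.1 + v z.2 + gam)| <=
  P * (`|\int[leb]_(y in b) cos (v y)| + `|\int[leb]_(y in b) sin (v y)|).
Proof.
move=> mA fA mu mb fb mv HP gam.
have mcos : measurable_fun setT (@cos R).
  by apply: continuous_measurable_fun; exact: continuous_cos.
have msin : measurable_fun setT (@sin R).
  by apply: continuous_measurable_fun; exact: continuous_sin.
pose F (z : T1 * measurableTypeR R) := cos (u z.1 + v z.2 + gam).
have mF : measurable_fun setT F.
  apply: measurableT_comp => //; apply: measurable_funD; last exact: measurable_cst.
  by apply: measurable_funD; apply: measurableT_comp.
have F1 x y : A x -> b y -> `|F (x, y)| <= 1 by move=> _ _; exact: cos_max.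
have icos : leb.-integrable b (EFin \o (fun y => cos (v y))).
  apply: (@integrable_of_bound _ _ _ _ _ _ 1) => //; first exact: measurableT_comp.
  by move=> *; exact: cos_max.
have isin : leb.-integrable b (EFin \o (fun y => sin (v y))).
  apply: (@integrable_of_bound _ _ _ _ _ _ 1) => //; first exact: measurableT_comp.
  by move=> *; exact: sin_max.
have iu g : m1.-integrable A (EFin \o (fun x => cos (u x + g))).
  apply: (@integrable_of_bound _ _ _ _ _ _ 1) => //.
    apply: measurableT_comp => //; apply: measurable_funD => //; exact: measurable_cst.
  by move=> *; exact: cos_max.
rewrite (fubini_bounded12 (F := F) mA mb fA fb mF F1).
set C := \int[leb]_(y in b) cos (v y).
set S := \int[leb]_(y in b) sin (v y).
have -> : \int[m1]_(x in A) \int[leb]_(y in b) F (x, y) =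
    \int[m1]_(x in A) (C * cos (u x + gam) + - S * cos (u x + (gam - pi / 2))).
  apply: eq_Rintegral => x _.
  transitivity (\int[leb]_(y in b) (cos (u x + gam) * cos (v y) +
      - sin (u x + gam) * sin (v y))).
    apply: eq_Rintegral => y _; rewrite /F /=.
    by rewrite (addrAC (u x)) (cosD (u x + gam)) mulNr.
  rewrite RintegralD//; [|exact: integrable_scale..].
  by rewrite !RintegralZl// addrA cosBpihalf -/C -/S; ring.
rewrite RintegralD//; [|exact: integrable_scale..].
rewrite !RintegralZl//.
apply: (le_trans (ler_normD _ _)); rewrite !normrM normrN mulrDr.
by apply: lerD; rewrite mulrC; apply: ler_wpM2r.
Qed.

End PhaseProduct.

(** * The torus and the product structure of the symbol *)

Section LebesguePowers.
Context (R : realType).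
Local Notation leb := (@lebesgue_measure R).
Local Notation mR := (measurableTypeR R).
Local Notation R4 := (mR * mR * mR * mR)%type.

Definition lebesgue1 : {sigma_finite_measure set mR -> \bar R} := leb.
Definition lebesgue2 : {sigma_finite_measure set (mR * mR)%type -> \bar R} :=
  sigma_product lebesgue1 lebesgue1.
Definition lebesgue3 : {sigma_finite_measure set (mR * mR * mR)%type -> \bar R} :=
  sigma_product lebesgue2 lebesgue1.
(** The same measure as [lebesgue4], bundled as a sigma-finite measure. *)
Definition sigma_lebesgue4 : {sigma_finite_measure set R4 -> \bar R} :=
  sigma_product lebesgue3 lebesgue1.

End LebesguePowers.

Section Torus.
Local Open Scope classical_set_scope.
Context (R : realType).
Local Notation leb := (@lebesgue_measure R).
Local Notation mR := (measurableTypeR R).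
Local Notation R4 := (mR * mR * mR * mR)%type.
Local Notation I := (`[- pi, pi]%classic : set mR).
Local Notation T4 := (@torus4 R).
Local Notation leb4 := (@sigma_lebesgue4 R).

(** The square of the frequency. *)
Definition symbol4 (p : R4) : R :=
  (2 - 2 * cos p.1.1.1) + (2 - 2 * cos p.1.1.2) + (2 - 2 * cos p.1.2) + (2 - 2 * cos p.2).

Definition pairing4 (n : 'I_4 -> R) (p : R4) : R :=
  n 0 * p.1.1.1 + n 1 * p.1.1.2 + n 2%:R * p.1.2 + n 3%:R * p.2.

Lemma dot4_pairing (x : 'rV[int]_4) p :
  dot4 x (vec4 p) = pairing4 (fun j => (x 0 j)%:~R) p.
Proof.
case: p => [[[a b] c] d]; rewrite /dot4 /pairing4 /=.
rewrite !big_ord_recl big_ord0 addr0 !mxE /= !addrA.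
by congr (_ * _ + _ * _ + _ * _ + _ * _); congr (x 0 _)%:~R; apply/val_inj.
Qed.

Lemma omega_symbol p : omega (vec4 p) = Num.sqrt (symbol4 p).
Proof.
case: p => [[[a b] c] d]; rewrite /omega /symbol4 /=.
by rewrite !big_ord_recl big_ord0 addr0 !mxE /= !addrA.
Qed.

Lemma symbol4_bounds p : 0 <= symbol4 p <= 16.
Proof.
rewrite /symbol4.
have := cos_le1 p.1.1.1; have := cos_le1 p.1.1.2; have := cos_le1 p.1.2.
have := cos_le1 p.2; have := cos_geN1 p.1.1.1; have := cos_geN1 p.1.1.2.
have := cos_geN1 p.1.2; have := cos_geN1 p.2.
by lra.
Qed.

Lemma measurable_cosR : measurable_fun setT (@cos R : mR -> mR).
Proof. by apply: continuous_measurable_fun; exact: continuous_cos. Qed.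

Lemma measurable_sinR : measurable_fun setT (@sin R : mR -> mR).
Proof. by apply: continuous_measurable_fun; exact: continuous_sin. Qed.

Lemma measurable_coord1 : measurable_fun setT (fun p : R4 => p.1.1.1).
Proof. by do 2 apply: measurableT_comp => //; exact: measurableT_comp. Qed.

Lemma measurable_coord2 : measurable_fun setT (fun p : R4 => p.1.1.2).
Proof. by do 2 apply: measurableT_comp => //; exact: measurableT_comp. Qed.

Lemma measurable_coord3 : measurable_fun setT (fun p : R4 => p.1.2).
Proof. by apply: measurableT_comp => //; exact: measurableT_comp. Qed.

Lemma measurable_coord4 : measurable_fun setT (fun p : R4 => p.2).
Proof. exact: measurable_snd. Qed.

Lemma measurable_symbol4 : measurable_fun setT symbol4.
Proof.
have m f : measurable_fun setT (f : R4 -> mR) ->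
    measurable_fun setT (fun p => 2 - 2 * cos (f p)).
  move=> mf; apply: measurable_funB; first exact: measurable_cst.
  apply: measurable_funM; first exact: measurable_cst.
  exact: (measurableT_comp measurable_cosR mf).
exact: (measurable_funD (measurable_funD (measurable_funD
  (m _ measurable_coord1) (m _ measurable_coord2))
  (m _ measurable_coord3)) (m _ measurable_coord4)).
Qed.

Lemma measurable_pairing4 n : measurable_fun setT (pairing4 n).
Proof.
have m c f : measurable_fun setT (f : R4 -> mR) -> measurable_fun setT (fun p => c * f p).
  by move=> mf; apply: measurable_funM.
exact: (measurable_funD (measurable_funD (measurable_funD
  (m (n 0) _ measurable_coord1) (m (n 1) _ measurable_coord2))
  (m (n 2%:R) _ measurable_coord3)) (m (n 3%:R) _ measurable_coord4)).
Qed.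

Lemma measurable_torus4 : measurable T4.
Proof. by repeat apply: measurableX. Qed.

Lemma leb_period_finite : (leb I < +oo)%E.
Proof.
by rewrite /= lebesgue_measure_itv/=; case: ifP => _; rewrite ?ltry.
Qed.

Lemma leb2_finite : (lebesgue2 R (I `*` I) < +oo)%E.
Proof. by apply: prod_measure_finite => //; exact: leb_period_finite. Qed.

Lemma leb3_finite : (lebesgue3 R (I `*` I `*` I) < +oo)%E.
Proof.
apply: prod_measure_finite => //; first exact: measurableX.
  exact: leb2_finite.
exact: leb_period_finite.
Qed.

Lemma leb4_torus_finite : (leb4 T4 < +oo)%E.
Proof.
have mI : measurable I by [].
exact: (@prod_measure_finite _ _ _ _ R (lebesgue3 R) (lebesgue1 R) _ _
  (measurableX (measurableX mI mI) mI) mI leb3_finite leb_period_finite).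
Qed.

Lemma period_norm_phase n s gam :
  `|\int[leb]_(x in I) cos (period_phase n s x + gam)| <= period_norm n s.
Proof.
have -> : \int[leb]_(x in I) cos (period_phase n s x + gam) =
  \int[leb]_(x in I) (cos gam * cos (period_phase n s x) +
                      - sin gam * sin (period_phase n s x)).
  by apply: eq_Rintegral => x _; rewrite cosD; ring.
rewrite RintegralD//; last 2 first.
- by apply: integrable_scale => //; exact: cos_period_integrable.
- by apply: integrable_scale => //; exact: sin_period_integrable.
rewrite !RintegralZl//; [|exact: sin_period_integrable|exact: cos_period_integrable].
apply: (le_trans (ler_normD _ _)); rewrite !normrM normrN.
by apply: lerD; rewrite ler_piMl// ?cos_max ?sin_max.
Qed.

Lemma measurable_period_phase n s : measurable_fun setT (period_phase n s : mR -> R).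
Proof.
apply: continuous_measurable_fun => x.
by apply: der_cont; exact: der_period_phase.
Qed.

(** Both [pairing4] and [symbol4] are sums over the coordinates, so the phase is a sum
    of four [period_phase]s and the integral factors. *)
Lemma torus_phase_bound (n : 'I_4 -> R) s gam :
  `|\int[leb4]_(p in T4) cos (pairing4 n p + s * symbol4 p + gam)| <=
  period_norm (n 0) s * period_norm (n 1) s *
  period_norm (n 2%:R) s * period_norm (n 3%:R) s.
Proof.
pose u k := period_phase (n k) s.
have -> : \int[leb4]_(p in T4) cos (pairing4 n p + s * symbol4 p + gam) =
  \int[leb4]_(p in T4) cos (u 0 p.1.1.1 + u 1 p.1.1.2 + u 2%:R p.1.2 + u 3%:R p.2 + gam).
  by apply: eq_Rintegral => p _; congr cos; rewrite /pairing4 /symbol4 /u /period_phase; ring.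
move: gam; rewrite /lebesgue4 /torus4.
have mI : measurable I by [].
have fI := leb_period_finite.
have mu k : measurable_fun setT (u k : mR -> R) := measurable_period_phase _ _.
have H1 := period_norm_phase (n 0) s.
have H2 := @phase_product_bound _ _ R (lebesgue1 R) I (u 0) (u 1) _ I
  mI fI (mu 0) mI fI (mu 1) H1.
have m2 : measurable_fun setT (fun z : mR * mR => u 0 z.1 + u 1 z.2).
  by apply: measurable_funD; apply: measurableT_comp.
have H3 := @phase_product_bound _ _ R (lebesgue2 R) _ _ (u 2%:R) _ I
  (measurableX mI mI) leb2_finite m2 mI fI (mu 2%:R) H2.
have m3 : measurable_fun setT (fun z : mR * mR * mR => u 0 z.1.1 + u 1 z.1.2 + u 2%:R z.2).
  apply: measurable_funD; last by apply: measurableT_comp.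
  by apply: (measurableT_comp (f := fun z : mR * mR => u 0 z.1 + u 1 z.2)).
exact: (@phase_product_bound _ _ R (lebesgue3 R) _ _ (u 3%:R) _ I
  (measurableX (measurableX mI mI) mI) leb3_finite m3 mI fI (mu 3%:R) H3).
Qed.

End Torus.

(** * The main term *)

Section MainTerm.
Local Open Scope classical_set_scope.
Context (R : realType).
Local Notation leb := (@lebesgue_measure R).
Local Notation mR := (measurableTypeR R).
Local Notation R4 := (mR * mR * mR * mR)%type.
Local Notation T4 := (@torus4 R).
Local Notation leb4 := (@sigma_lebesgue4 R).

Lemma measurable_high_cut : measurable_fun setT (@high_cut R : mR -> mR).
Proof.
have -> : @high_cut R = fun x => 1 - cutoff (Num.min x (1 / 4)).
  apply/funext => x; rewrite /high_cut; case: leP => // _.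
  have -> : cutoff (1 / 4 : R) = 0; last by rewrite subr0.
  rewrite /cutoff (_ : (1 / 4) ^+ 4 = 1 / 256); last by field.
  by rewrite (_ : 1 - _ = 0) ?expr0n//; field.
apply: measurable_funB; first exact: measurable_cst.
apply: (measurableT_comp (f := @cutoff R)).
  by apply: continuous_measurable_fun => x; exact: der_cont (der_cutoff x).
by apply: measurable_minr; [exact: measurable_id|exact: measurable_cst].
Qed.

Lemma measurable_phase4 :
  measurable_fun setT (fun z : R4 * mR => phase (symbol4 z.1) z.2).
Proof.
apply: measurable_funD.
  have e : (fun z : R4 * mR => (4 * z.2 ^+ 2)^-1) =
           (fun z => (4 * z.2 ^+ 2) `^ (-1)).
    apply/funext => z; rewrite powR_inv1//.
    by rewrite mulr_ge0// sqr_ge0.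
  rewrite e; apply: (measurableT_comp (measurable_powR (-1))).
  apply: measurable_funM; first exact: measurable_cst.
  by apply: measurable_funX; exact: measurable_snd.
apply: measurable_funM; first exact: (measurableT_comp (@measurable_symbol4 R)).
by apply: measurable_funX; exact: measurable_snd.
Qed.

Lemma measurable_modulation n (be : R) :
  measurable_fun setT (fun z : R4 * mR => cos (pairing4 n z.1 + be)).
Proof.
apply: (measurableT_comp (@measurable_cosR R)).
apply: measurable_funD; last exact: measurable_cst.
exact: (measurableT_comp (@measurable_pairing4 R n)).
Qed.

Lemma measurable_cos_phase4 (t al : R) :
  measurable_fun setT (fun z : R4 * mR => cos (t * phase (symbol4 z.1) z.2 + al)).
Proof.
apply: (measurableT_comp (@measurable_cosR R)).
apply: measurable_funD; last exact: measurable_cst.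
by apply: measurable_funM; [exact: measurable_cst|exact: measurable_phase4].
Qed.

Definition main_integrand n (be t al : R) (z : R4 * mR) : R :=
  cos (pairing4 n z.1 + be) * (high_cut z.2 * cos (t * phase (symbol4 z.1) z.2 + al)).

Lemma measurable_main_integrand n be t al :
  measurable_fun setT (main_integrand n be t al).
Proof.
apply: measurable_funM; first exact: measurable_modulation.
apply: measurable_funM; last exact: measurable_cos_phase4.
exact: (measurableT_comp measurable_high_cut).
Qed.

Lemma norm_main_integrand_le n be t al p tau : 0 <= tau ->
  `|main_integrand n be t al (p, tau)| <= 1.
Proof.
move=> t0; rewrite /main_integrand !normrM /= -[leRHS](mulr1 1).
apply: ler_pM => //; first exact: cos_max.
rewrite -[leRHS](mulr1 1); apply: ler_pM => //; last exact: cos_max.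
by rewrite ger0_norm ?high_cut_ge0// high_cut_le1.
Qed.

Lemma segment_finite (a b : R) : (leb `[a, b] < +oo)%E.
Proof. by rewrite /= lebesgue_measure_itv/=; case: ifP => _; rewrite ?ltry. Qed.

Lemma amgm4 (a b c d : R) : 0 <= a -> 0 <= b -> 0 <= c -> 0 <= d ->
  a * b * c * d <= (a ^+ 4 + b ^+ 4 + c ^+ 4 + d ^+ 4) / 4.
Proof.
move=> a0 b0 c0 d0.
have h (x y : R) : x * y <= (x ^+ 2 + y ^+ 2) / 2 by have := sqr_ge0 (x - y); nra.
have := h (a * b) (c * d); have := h (a ^+ 2) (b ^+ 2); have := h (c ^+ 2) (d ^+ 2).
have e (x : R) : (x ^+ 2) ^+ 2 = x ^+ 4 by rewrite -exprM.
rewrite !e.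
have -> : (a * b) ^+ 2 = a ^+ 2 * b ^+ 2 by ring.
have -> : (c * d) ^+ 2 = c ^+ 2 * d ^+ 2 by ring.
have -> : a * b * c * d = a * b * (c * d) by ring.
move: (a ^+ 2 * b ^+ 2) (c ^+ 2 * d ^+ 2) (a * b * (c * d)).
by move: (a ^+ 4) (b ^+ 4) (c ^+ 4) (d ^+ 4) => *; lra.
Qed.

(** A product of two cosines is half the sum of the cosines of the sum and of the
    difference of the arguments, so the slice is a mean of two torus integrals with
    [s = t tau ^ 2] and [s = - t tau ^ 2], to which [torus_phase_bound] applies. *)
Lemma slice_bound n (be t al tau : R) : 1 <= t -> 0 < tau ->
  `|\int[leb4]_(p in T4) main_integrand n be t al (p, tau)| <=
  (2048 * 64 ^+ 4) * t ^- 2 *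
   ((majorant (Num.sqrt (`|n 0| / (2 * t))) (t ^- 2) tau +
     majorant (Num.sqrt (`|n 1| / (2 * t))) (t ^- 2) tau +
     majorant (Num.sqrt (`|n 2%:R| / (2 * t))) (t ^- 2) tau +
     majorant (Num.sqrt (`|n 3%:R| / (2 * t))) (t ^- 2) tau) / 4).
Proof.
move=> t1 tau0.
have [B BE] : exists B : R, B = 2048 * 64 ^+ 4 by exists (2048 * 64 ^+ 4).
rewrite -BE.
pose s := t * tau ^+ 2.
have s0 : 0 < s by rewrite mulr_gt0 ?exprn_gt0//; lra.
pose c := t * (4 * tau ^+ 2)^-1 + al.
have ip sg g : leb4.-integrable T4
    (EFin \o (fun p => cos (pairing4 n p + sg * symbol4 p + g))).
  apply: (@integrable_of_bound _ _ _ _ _ _ 1).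
  - exact: measurable_torus4.
  - exact: leb4_torus_finite.
  - apply: (measurableT_comp (@measurable_cosR R)).
    apply: measurable_funD; last exact: measurable_cst.
    apply: measurable_funD; first exact: measurable_pairing4.
    by apply: measurable_funM; [exact: measurable_cst|exact: measurable_symbol4].
  - by move=> *; exact: cos_max.
have h0 : 0 <= high_cut tau by rewrite high_cut_ge0// ltW.
pose J sg g := \int[leb4]_(p in T4) cos (pairing4 n p + sg * symbol4 p + g).
have -> : \int[leb4]_(p in T4) main_integrand n be t al (p, tau) =
    high_cut tau / 2 * J s (be + c) + high_cut tau / 2 * J (- s) (be - c).
  rewrite /J -!RintegralZl//; [|exact: measurable_torus4|exact: measurable_torus4].
  rewrite -RintegralD//; last 3 first.
  - exact: measurable_torus4.
  - by apply: integrable_scale; [exact: measurable_torus4|exact: ip].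
  - by apply: integrable_scale; [exact: measurable_torus4|exact: ip].
  apply: eq_Rintegral => p _; rewrite /main_integrand /=.
  have -> : t * phase (symbol4 p) tau + al = s * symbol4 p + c.
    by rewrite /phase /s /c; ring.
  have -> : pairing4 n p + s * symbol4 p + (be + c) =
    (pairing4 n p + be) + (s * symbol4 p + c) by ring.
  have -> : pairing4 n p + - s * symbol4 p + (be - c) =
    (pairing4 n p + be) - (s * symbol4 p + c) by ring.
  by rewrite (cosD (_ + be)) (cosB (_ + be)); field.
have side sg g : `|sg| = s -> high_cut tau * `|J sg g| <=
   B * t ^- 2 *
   ((majorant (Num.sqrt (`|n 0| / (2 * t))) (t ^- 2) tau +
     majorant (Num.sqrt (`|n 1| / (2 * t))) (t ^- 2) tau +
     majorant (Num.sqrt (`|n 2%:R| / (2 * t))) (t ^- 2) tau +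
     majorant (Num.sqrt (`|n 3%:R| / (2 * t))) (t ^- 2) tau) / 4).
  move=> sgs.
  have hk k := @period_norm4_majorant R (n k) t tau sg t1 tau0 sgs.
  have k0 k := period_norm_ge0 (n k) sg.
  have := hk 0; have := hk 1; have := hk 2%:R; have := hk 3%:R.
  have := amgm4 (k0 0) (k0 1) (k0 2%:R) (k0 3%:R).
  have := torus_phase_bound n sg g; rewrite -/(J sg g) -BE.
  set M0 := majorant (Num.sqrt (`|n 0| / _)) _ _.
  set M1 := majorant (Num.sqrt (`|n 1| / _)) _ _.
  set M2 := majorant (Num.sqrt (`|n 2%:R| / _)) _ _.
  set M3 := majorant (Num.sqrt (`|n 3%:R| / _)) _ _.
  move: (period_norm (n 0) sg) (period_norm (n 1) sg) (period_norm (n 2%:R) sg)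
    (period_norm (n 3%:R) sg) => K0 K1 K2 K3 hJ ha h3 h2 h1 h0'.
  apply: (@le_trans _ _ (high_cut tau * ((K0 ^+ 4 + K1 ^+ 4 + K2 ^+ 4 + K3 ^+ 4) / 4))).
    by apply: ler_wpM2l => //; exact: le_trans ha.
  have -> : B * t ^- 2 * ((M0 + M1 + M2 + M3) / 4) =
    (B * (t ^- 2 * M0) + B * (t ^- 2 * M1) + B * (t ^- 2 * M2) + B * (t ^- 2 * M3)) / 4.
    by field; lra.
  have -> : high_cut tau * ((K0 ^+ 4 + K1 ^+ 4 + K2 ^+ 4 + K3 ^+ 4) / 4) =
    (high_cut tau * K0 ^+ 4 + high_cut tau * K1 ^+ 4 + high_cut tau * K2 ^+ 4 +
     high_cut tau * K3 ^+ 4) / 4 by field.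
  by rewrite ler_pM2r ?invr_gt0//; do 3 (apply: lerD => //).
apply: (le_trans (ler_normD _ _)).
have half y : `|high_cut tau / 2 * y| = high_cut tau * `|y| / 2.
  by rewrite normrM ger0_norm ?divr_ge0//; ring.
rewrite !half.
have := side s (be + c) (gtr0_norm s0).
have := side (- s) (be - c) (etrans (normrN _) (gtr0_norm s0)).
move: (B * _ * _) (high_cut tau * _) (high_cut tau * _) => X Y Z ? ?; lra.
Qed.

(** After exchanging the integrals, absolute values are taken in [tau]: the decay comes
    from the torus integral of each slice alone. *)
Lemma main_term_bound n (be t al a b : R) : 1 <= t -> 0 < a -> a <= b ->
  `|\int[leb4]_(p in T4) \int[leb]_(tau in `[a, b]) main_integrand n be t al (p, tau)| <=
  (2048 * 64 ^+ 4) * t ^- 2 * (2 * pi + 2 * ln (1 + t ^+ 2)).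
Proof.
move=> t1 a0 ab.
have [B BE B0] : exists2 B : R, B = 2048 * 64 ^+ 4 & 0 <= B.
  exists (2048 * 64 ^+ 4); first by [].
  by apply: mulr_ge0; [exact: ler0n|apply: exprn_ge0; exact: ler0n].
rewrite -BE.
have mT := @measurable_torus4 R.
have fT := @leb4_torus_finite R.
have mI : measurable (`[a, b]%classic : set mR) by [].
have fI := segment_finite a b.
have mF := measurable_main_integrand n be t al.
have FM (x : R4) (y : mR) : T4 x -> `[a, b]%classic y ->
    `|main_integrand n be t al (x, y)| <= 1.
  move=> _; rewrite /= in_itv/= => /andP[ay _].
  by apply: norm_main_integrand_le; rewrite (le_trans _ ay)// ltW.
have E : \int[leb4]_(p in T4) \int[leb]_(tau in `[a, b]) main_integrand n be t al (p, tau) =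
    \int[leb]_(tau in `[a, b]) \int[leb4]_(p in T4) main_integrand n be t al (p, tau).
  have e12 := @fubini_bounded12 _ _ _ _ R (sigma_lebesgue4 R) (lebesgue1 R) _ _ _ 1
    mT mI fT fI mF FM.
  have e21 := @fubini_bounded21 _ _ _ _ R (sigma_lebesgue4 R) (lebesgue1 R) _ _ _ 1
    mT mI fT fI mF FM.
  exact: etrans (esym e12) e21.
rewrite E.
have iI : leb.-integrable `[a, b] (EFin \o
    (fun tau => \int[leb4]_(p in T4) main_integrand n be t al (p, tau))).
  exact: (@integrable_inner2 _ _ _ _ R (sigma_lebesgue4 R) (lebesgue1 R) _ _ _ 1
    mT mI fT fI mF FM).
have eps0 : 0 < t ^- 2 by rewrite invr_gt0 exprn_gt0//; lra.
pose r k := Num.sqrt (`|n k| / (2 * t)).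
have iM k := (majorant_integral (r k) eps0 ab).1.
have bM k := (majorant_integral (r k) eps0 ab).2.
have iMC k : leb.-integrable `[a, b]
    (EFin \o (fun tau => B * t ^- 2 / 4 * majorant (r k) (t ^- 2) tau)).
  by apply: integrable_scale => //; exact: iM.
pose G tau := B * t ^- 2 / 4 * majorant (r 0) (t ^- 2) tau +
    B * t ^- 2 / 4 * majorant (r 1) (t ^- 2) tau +
    B * t ^- 2 / 4 * majorant (r 2%:R) (t ^- 2) tau +
    B * t ^- 2 / 4 * majorant (r 3%:R) (t ^- 2) tau.
have iG1 := integrableD mI (iMC 0) (iMC 1).
have iG2 := integrableD mI iG1 (iMC 2%:R).
have iG : leb.-integrable `[a, b] (EFin \o G) := integrableD mI iG2 (iMC 3%:R).
apply: (le_trans (le_normr_Rintegral mI iI)).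
apply: (@le_trans _ _ (\int[leb]_(tau in `[a, b]) G tau)).
  apply: le_Rintegral => //; first by have := integrable_norm iI.
  move=> tau; rewrite /= in_itv/= => /andP[atau _].
  have tau0 : 0 < tau by exact: lt_le_trans atau.
  apply: (le_trans (slice_bound n be al t1 tau0)).
  by rewrite -BE /G -/(r 0) -/(r 1) -/(r 2%:R) -/(r 3%:R) le_eqVlt; apply/orP; left;
    apply/eqP; field; lra.
rewrite /G !RintegralD//.
do 4 (rewrite RintegralZl; [|by []|exact: iM]).
have q0 : 0 <= B * t ^- 2 / 4 by rewrite divr_ge0// mulr_ge0// ltW.
have -> : B * t ^- 2 * (2 * pi + 2 * ln (1 + t ^+ 2)) =
  B * t ^- 2 / 4 * (2 * pi + 2 * ln (1 + t ^+ 2)) +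
  B * t ^- 2 / 4 * (2 * pi + 2 * ln (1 + t ^+ 2)) +
  B * t ^- 2 / 4 * (2 * pi + 2 * ln (1 + t ^+ 2)) +
  B * t ^- 2 / 4 * (2 * pi + 2 * ln (1 + t ^+ 2)) by field; lra.
have bM' k : \int[leb]_(x in `[a, b]) majorant (r k) (t ^- 2) x <=
    2 * pi + 2 * ln (1 + t ^+ 2) by have := bM k; rewrite invrK.
by apply: lerD; [apply: lerD; [apply: lerD|]|]; apply: ler_wpM2l.
Qed.

End MainTerm.

(** * Integrability of the inverse frequency *)

Section IntegrableProduct.
Local Open Scope classical_set_scope.
Context d1 d2 (T1 : measurableType d1) (T2 : measurableType d2) (R : realType).
Context (m1 : {sigma_finite_measure set T1 -> \bar R}).
Context (m2 : {sigma_finite_measure set T2 -> \bar R}).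

Lemma integrable_prodX (f : T1 -> R) (g : T2 -> R) (A : set T1) (B : set T2) :
  measurable A -> measurable B ->
  m1.-integrable A (EFin \o f) -> m2.-integrable B (EFin \o g) ->
  (m1 \x m2)%E.-integrable (A `*` B) (EFin \o (fun z => f z.1 * g z.2)).
Proof.
move=> mA mB fi gi.
have fi' : m1.-integrable setT (EFin \o (f \_ A)).
  by rewrite -restrict_EFin -integrable_mkcond.
have gi' : m2.-integrable setT (EFin \o (g \_ B)).
  by rewrite -restrict_EFin -integrable_mkcond.
have mf : measurable_fun setT (f \_ A) by exact/measurable_EFinP/(measurable_int m1).
have mg : measurable_fun setT (g \_ B) by exact/measurable_EFinP/(measurable_int m2).
rewrite integrable_mkcond; last exact: measurableX.
have -> : (EFin \o (fun z : T1 * T2 => f z.1 * g z.2)) \_ (A `*` B) =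
    EFin \o (fun z => (f \_ A) z.1 * (g \_ B) z.2).
  apply/funext => -[x y]; rewrite restrict_setX /= !patchE.
  by case: ifP => _; case: ifP => _; rewrite ?mulr0 ?mul0r.
have mh : measurable_fun setT (fun z : T1 * T2 => (f \_ A) z.1 * (g \_ B) z.2).
  by apply: measurable_funM; apply: measurableT_comp.
apply/integrable12ltyP; first exact/measurable_EFinP.
have [_ foo] := integrableP _ _ _ fi'; have [_ goo] := integrableP _ _ _ gi'.
have goo' : (\int[m2]_y `|(EFin \o (g \_ B)) y| \is a fin_num)%E.
  by rewrite ge0_fin_numE// integral_ge0.
rewrite (_ : (\int[m1]_x \int[m2]_y _)%E =
  (\int[m1]_x (`|(EFin \o (f \_ A)) x| * \int[m2]_y `|(EFin \o (g \_ B)) y|))%E).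
  rewrite ge0_integralZr//; last 2 first.
  - by apply: measurableT_comp => //; exact/measurable_EFinP.
  - exact: integral_ge0.
  apply: lte_mul_pinfty; [exact: integral_ge0| |exact: goo].
  by rewrite ge0_fin_numE//; exact: integral_ge0.
apply: eq_integral => x _.
rewrite -ge0_integralZl//; last by apply: measurableT_comp => //; exact/measurable_EFinP.
by apply: eq_integral => y _; rewrite /= normrM EFinM.
Qed.

End IntegrableProduct.

Section Domination.
Local Open Scope classical_set_scope.
Context (R : realType).
Local Notation leb := (@lebesgue_measure R).
Local Notation mR := (measurableTypeR R).
Local Notation I := (`[- pi, pi]%classic : set mR).

(** A power rather than the inverse of a square root, because the measurability of
    powers is immediate.  At [0] its value is [0]. *)
Definition inv_sqrt (x : R) : R := `|x| `^ (- (1 / 2)).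

Lemma inv_sqrtE x : x != 0 -> inv_sqrt x = (Num.sqrt `|x|)^-1.
Proof.
move=> x0; rewrite /inv_sqrt powRN; congr (_^-1).
by rewrite -powR12_sqrt// div1r.
Qed.

Lemma inv_sqrt_ge0 x : 0 <= inv_sqrt x. Proof. exact: powR_ge0. Qed.

Lemma measurable_inv_sqrt : measurable_fun setT (inv_sqrt : mR -> mR).
Proof.
apply: (measurableT_comp (measurable_powR (- (1 / 2)))).
exact: normr_measurable.
Qed.

Lemma integral_inv_sqrt (e c : R) : 0 < e -> e <= c ->
  (\int[leb]_(x in `[e, c]) (inv_sqrt x)%:E <= (2 * Num.sqrt c)%:E)%E.
Proof.
move=> e0 ec.
have n0 x : e <= x <= c -> 0 < x by move=> /andP[ex _]; exact: lt_le_trans ex.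
have ci x : e <= x <= c -> {for x, continuous (fun x => (Num.sqrt x)^-1)}.
  move=> /n0 x0; apply: der_cont.
  by apply: derV; [rewrite sqrtr_eq0 -ltNge|apply: der_sqrt; [exact: x0|exact: der_id]].
have F : \int[leb]_(x in `[e, c]) (Num.sqrt x)^-1 = 2 * Num.sqrt c - 2 * Num.sqrt e.
  apply: (@FTC _ _ (fun x => 2 * Num.sqrt x) _ _ ec) => // x /n0 x0.
  apply: der_eq; first by apply: derM; [exact: der_cst|apply: der_sqrt; [exact: x0|exact: der_id]].
  by rewrite /=; field; rewrite gt_eqF// sqrtr_gt0.
rewrite (_ : (\int[leb]_(x in `[e, c]) _)%E =
  (\int[leb]_(x in `[e, c]) ((Num.sqrt x)^-1)%:E)%E); last first.
  apply: eq_integral => x; rewrite inE/= in_itv/= => /n0 x0.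
  by rewrite inv_sqrtE ?gt_eqF// gtr0_norm.
have -> : (\int[leb]_(x in `[e, c]) ((Num.sqrt x)^-1)%:E)%E =
    (\int[leb]_(x in `[e, c]) (Num.sqrt x)^-1)%:E.
  by rewrite /Rintegral fineK//; apply: integrable_fin_num => //; exact: cont_integrable.
by rewrite F lee_fin lerBlDr lerDl mulr_ge0// sqrtr_ge0.
Qed.

Lemma integral_inv_sqrtN (e c : R) : 0 < e -> e <= c ->
  (\int[leb]_(x in `[(- c)%R, (- e)%R]) (inv_sqrt x)%:E <= (2 * Num.sqrt c)%:E)%E.
Proof.
move=> e0 ec.
have ecN : - c <= - e by rewrite lerN2.
have n0 x : - c <= x <= - e -> 0 < - x by move=> /andP[_ ex]; lra.
have dN (x : R) : has_deriv x (fun y => - y) (- 1) by der.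
have ci x : - c <= x <= - e -> {for x, continuous (fun x => (Num.sqrt (- x))^-1)}.
  move=> /n0 x0; apply: der_cont; apply: derV; last exact: der_sqrt (dN x).
  by rewrite sqrtr_eq0 -ltNge.
have F : \int[leb]_(x in `[(- c)%R, (- e)%R]) (Num.sqrt (- x))^-1 =
    - (2 * Num.sqrt (- - e)) - - (2 * Num.sqrt (- - c)).
  apply: (@FTC _ _ (fun x => - (2 * Num.sqrt (- x))) _ _ ecN) => // x /n0 x0.
  apply: der_eq; first by apply: derN; apply: derM; [exact: der_cst|exact: der_sqrt (dN x)].
  by rewrite /=; field; rewrite gt_eqF// sqrtr_gt0.
rewrite (_ : (\int[leb]_(x in `[(- c)%R, (- e)%R]) _)%E =
  (\int[leb]_(x in `[(- c)%R, (- e)%R]) ((Num.sqrt (- x))^-1)%:E)%E); last first.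
  apply: eq_integral => x; rewrite inE/= in_itv/= => /n0 x0.
  by rewrite inv_sqrtE ?lt_eqF -?oppr_gt0// -normrN gtr0_norm.
have -> : (\int[leb]_(x in `[(- c)%R, (- e)%R]) ((Num.sqrt (- x))^-1)%:E)%E =
    (\int[leb]_(x in `[(- c)%R, (- e)%R]) (Num.sqrt (- x))^-1)%:E.
  by rewrite /Rintegral fineK//; apply: integrable_fin_num => //; exact: cont_integrable.
by rewrite F !opprK lee_fin addrC lerBlDr lerDl mulr_ge0// sqrtr_ge0.
Qed.

(** Monotone convergence along the sets [1 / (k + 1) <= |x| <= pi], on which the
    primitive [2 sqrt |x|] gives a uniform bound. *)
Lemma integrable_inv_sqrt : leb.-integrable I (EFin \o inv_sqrt).
Proof.
pose F (k : nat) : set mR := `[- pi, - k.+1%:R^-1]%classic `|` `[k.+1%:R^-1, pi]%classic.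
have pi2 : 2 <= pi :> R := pi_ge2 R.
have k0 k : 0 < k.+1%:R^-1 :> R by rewrite invr_gt0.
have k1 k : k.+1%:R^-1 <= pi :> R.
  by apply: (@le_trans _ _ 1); [rewrite invf_le1// ler1n|lra].
have mF k : measurable (F k) by exact: measurableU.
have mw := measurable_inv_sqrt.
have mw' (D : set mR) : measurable_fun D (EFin \o inv_sqrt).
  by apply/measurable_EFinP; exact: measurable_funTS.
have bF k : (\int[leb]_(x in F k) (inv_sqrt x)%:E <= (4 * Num.sqrt pi)%:E)%E.
  rewrite /F ge0_integral_setU//; last 2 first.
  - by move=> x _; rewrite lee_fin inv_sqrt_ge0.
  - apply/disj_setPS => x [/=]; rewrite !in_itv/= => /andP[_ h1] /andP[h2 _].
    by move: h1 h2 (k0 k); move: (k.+1%:R^-1) => e; lra.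
  have -> : 4 * Num.sqrt pi = 2 * Num.sqrt pi + 2 * Num.sqrt pi :> R by ring.
  by rewrite EFinD; apply: leeD; [exact: integral_inv_sqrtN|exact: integral_inv_sqrt].
apply/integrableP; split; first exact: mw'.
apply: (@le_lt_trans _ _ (4 * Num.sqrt pi)%:E); last exact: ltry.
have -> : (\int[leb]_(x in I) `|(EFin \o inv_sqrt) x|)%E =
    (\int[leb]_(x in \bigcup_k F k) (inv_sqrt x)%:E)%E.
  rewrite [LHS]integral_mkcond [RHS]integral_mkcond; apply: eq_integral => x _.
  rewrite !patchE /= (ger0_norm (inv_sqrt_ge0 x)).
  have [->|x0] := eqVneq x 0.
    have -> : inv_sqrt 0 = 0.
      by rewrite /inv_sqrt normr0 powR0// oppr_eq0 div1r invr_eq0.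
    by rewrite !if_same.
  case: ifPn => [/set_mem|] xI.
    rewrite ifT//; apply/mem_set.
    have nx : 0 < `|x|^-1 by rewrite invr_gt0 normr_gt0.
    have [k hk] : exists k : nat, `|x|^-1 <= k.+1%:R.
      exists (Num.bound `|x|^-1); apply: (le_trans (ler_norm _)).
      apply: (le_trans (ltW (archi_boundP (normr_ge0 _)))).
      by rewrite ger0_norm ?(ltW nx)// ler_nat.
    have kx : k.+1%:R^-1 <= `|x|.
      by rewrite -[leRHS]invrK lef_pV2 ?posrE.
    exists k => //; move: xI kx; rewrite /F /= !in_itv/= => /andP[xl xr].
    have [h|h] := leP 0 x.
      by rewrite ger0_norm// => kx; right; apply/andP.
    rewrite ltr0_norm// => kx; left; apply/andP; split => //.
    by move: kx; move: (k.+1%:R^-1) => e; lra.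
  rewrite ifF//; apply/negbTE; apply: contra xI => /set_mem[k _].
  rewrite /F /= !in_itv/= => -[] /andP[h1 h2]; apply/mem_set; rewrite /= in_itv/=;
    move: h1 h2 (k0 k); move: (k.+1%:R^-1) => e; lra.
have ndF : nondecreasing_seq F.
  move=> i j ij; apply/subsetPset => x.
  have ji : j.+1%:R^-1 <= i.+1%:R^-1 :> R.
    by rewrite lef_pV2 ?posrE// ler_nat.
  by rewrite /F /= !in_itv/= => -[] /andP[h1 h2]; [left|right]; apply/andP; split => //;
    move: h1 h2 ji; move: (j.+1%:R^-1) (i.+1%:R^-1) => e e'; lra.
have := @ge0_nondecreasing_set_cvg_integral _ _ R F (EFin \o inv_sqrt) leb ndF mF
  (fun i => mw' (F i)) (fun i x _ => inv_sqrt_ge0 x).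
move=> h; rewrite -(cvg_lim _ h)//; apply: lime_le.
  by apply/cvg_ex; eexists; exact: h.
by near=> k; exact: bF.
Unshelve. all: by end_near. Qed.

Lemma symbol1_ge (x : R) : - pi <= x <= pi -> x ^+ 2 / 16 <= 2 - 2 * cos x.
Proof.
wlog x0 : x / 0 <= x.
  move=> H xpi; have [|/ltW x0] := leP 0 x; first by move=> ?; exact: H.
  by rewrite -sqrrN -cosN; apply: H; [rewrite oppr_ge0|lra].
move=> /andP[_ xpi].
have pi4 : pi <= 4 :> R by have := pihalf_lt2 R; lra.
have -> : 2 - 2 * cos x = 4 * sin (x / 2) ^+ 2 by rewrite (cos_half x); ring.
suff h : x / 8 <= sin (x / 2).
  have : (x / 8) ^+ 2 <= sin (x / 2) ^+ 2.
    by rewrite lerXn2r ?nnegrE//; [lra|apply: le_trans h; lra].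
  have -> : (x / 8) ^+ 2 = x ^+ 2 / 64 by field.
  lra.
have [x2|x2] := leP x 2.
  have : 0 <= x / 2 <= 1 by lra.
  by move=> /sin_ge_half; lra.
apply: (@le_trans _ _ (sin 1)).
  by have := @sin_ge_half R 1; rewrite ler01 lexx => /(_ isT); lra.
have pih : 1 <= pi / 2 :> R := pihalf_ge1 R.
rewrite leNgt ltr_sin; first by rewrite -leNgt; lra.
  by rewrite in_itv/=; lra.
by rewrite in_itv/=; lra.
Qed.

End Domination.

(** * Passage to the whole half-line *)

Section Limit.
Local Open Scope classical_set_scope.
Context (R : realType).
Local Notation leb := (@lebesgue_measure R).
Local Notation mR := (measurableTypeR R).
Local Notation R4 := (mR * mR * mR * mR)%type.
Local Notation I := (`[- pi, pi]%classic : set mR).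
Local Notation T4 := (@torus4 R).
Local Notation leb4 := (@sigma_lebesgue4 R).
Implicit Types (n : 'I_4 -> R) (p : R4).

Definition freq p : R := Num.sqrt (symbol4 p).

Definition full_integrand n (be t al : R) (z : R4 * mR) : R :=
  cos (pairing4 n z.1 + be) * cos (t * phase (symbol4 z.1) z.2 + al).

Lemma measurable_full_integrand n be t al :
  measurable_fun setT (full_integrand n be t al).
Proof.
by apply: measurable_funM; [exact: measurable_modulation|exact: measurable_cos_phase4].
Qed.

Lemma norm_full_integrand_le n be t al z : `|full_integrand n be t al z| <= 1.
Proof.
rewrite /full_integrand normrM -[leRHS](mulr1 1).
by apply: ler_pM => //; exact: cos_max.
Qed.

(** The subordination integral restricted to [[a, b]], with the plane wave as a factor. *)
Definition truncation n (be t al a b : R) p : R :=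
  Num.sqrt t * \int[leb]_(tau in `[a, b]) full_integrand n be t al (p, tau).

Lemma integrable_truncation n be t al a b :
  leb4.-integrable T4 (EFin \o truncation n be t al a b).
Proof.
apply: integrable_scale; first exact: measurable_torus4.
have FM (x : R4) (y : mR) : T4 x -> `[a, b]%classic y ->
    `|full_integrand n be t al (x, y)| <= 1.
  by move=> _ _; exact: norm_full_integrand_le.
exact: (@integrable_inner1 _ _ _ _ R leb4 (lebesgue1 R) _ _ `[a, b]%classic 1
  (@measurable_torus4 R) (measurable_itv _) (@leb4_torus_finite R) (segment_finite a b)
  (measurable_full_integrand n be t al) FM).
Qed.

Lemma integrable_main_slice n be t al a b p : 0 < a ->
  leb.-integrable `[a, b] (EFin \o (fun tau => main_integrand n be t al (p, tau))).
Proof.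
move=> a0; apply: (@integrable_of_bound _ _ _ _ _ _ 1) => //.
- exact: segment_finite.
- apply: (measurableT_comp (measurable_main_integrand n be t al)).
  exact: pair1_measurable.
- move=> tau; rewrite /= in_itv/= => /andP[atau _].
  by apply: norm_main_integrand_le; rewrite (le_trans (ltW a0)).
Qed.

Lemma integrable_full_slice n be t al a b p :
  leb.-integrable `[a, b] (EFin \o (fun tau => full_integrand n be t al (p, tau))).
Proof.
apply: (@integrable_of_bound _ _ _ _ _ _ 1) => //.
- exact: segment_finite.
- apply: (measurableT_comp (measurable_full_integrand n be t al)).
  exact: pair1_measurable.
- by move=> *; exact: norm_full_integrand_le.
Qed.

(** The difference of the two integrands is [cutoff] on [tau <= 1/4] and vanishes
    beyond. *)
Lemma full_minus_main_bound n be t al a b p : 1 <= t -> 0 < a -> a <= 1 / 4 -> t * a <= 1 ->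
  1 / 4 <= b ->
  `|\int[leb]_(tau in `[a, b]) full_integrand n be t al (p, tau) -
    \int[leb]_(tau in `[a, b]) main_integrand n be t al (p, tau)| <=
  10 * ibp_bound R ^+ 3 / t ^+ 2.
Proof.
move=> t1 a0 a4 ta b4.
have ab : a <= b by exact: le_trans b4.
rewrite -RintegralB//; last 2 first.
- exact: integrable_full_slice.
- exact: integrable_main_slice.
pose th tau := t * phase (symbol4 p) tau + al.
have idiff u : a <= u -> leb.-integrable `[u, b] (EFin \o (fun tau =>
    full_integrand n be t al (p, tau) - main_integrand n be t al (p, tau))).
  move=> au.
  have u0 : 0 < u by exact: lt_le_trans au.
  have mJ : measurable (`[u, b]%classic : set mR) by [].
  have := integrableB mJ (integrable_full_slice n be t al u b p)
    (integrable_main_slice n be t al b p u0).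
  by apply: eq_integrable.
rewrite (@integral_split _ _ a (1 / 4) b)//; last exact: idiff.
have -> : \int[leb]_(tau in `[1 / 4, b]) (full_integrand n be t al (p, tau) -
    main_integrand n be t al (p, tau)) = 0.
  rewrite (_ : \int[leb]_(tau in _) _ = \int[leb]_(tau in `[1 / 4, b]) 0).
    by rewrite Rintegral_cst// mul0r.
  apply: eq_Rintegral => tau; rewrite inE/= in_itv/= => /andP[h _].
  rewrite /full_integrand /main_integrand /=.
  suff -> : high_cut tau = 1 by rewrite mul1r subrr.
  rewrite /high_cut; case: leP => // h'.
  have -> : tau = 1 / 4 by apply/le_anti; rewrite h h'.
  rewrite /cutoff (_ : (1 / 4) ^+ 4 = 1 / 256); last by field.
  by rewrite (_ : 1 - 256 * _ = 0) ?expr0n ?subr0//; field.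
rewrite addr0.
have cc x : a <= x <= 1 / 4 ->
    {for x, continuous (fun tau => cutoff tau * cos (th tau))}.
  move=> /andP[ax _]; have x0 : x != 0 by rewrite gt_eqF// (lt_le_trans a0).
  apply: continuousM; first exact: der_cont (der_cutoff x).
  exact: continuous_cos_phase.
rewrite (_ : \int[leb]_(tau in _) _ =
    \int[leb]_(tau in `[a, 1 / 4]) (cos (pairing4 n p + be) * (cutoff tau * cos (th tau)))).
  rewrite RintegralZl//; last exact: cont_integrable.
  rewrite normrM -[leRHS]mul1r; apply: ler_pM => //; first exact: cos_max.
  by apply: cutoff_integral_bound => //; exact: symbol4_bounds.
apply: eq_Rintegral => tau; rewrite inE/= in_itv/= => /andP[_ h].
by rewrite /full_integrand /main_integrand /high_cut h /=; ring.
Qed.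

Definition decay_bound (t : R) : R :=
  (2048 * 64 ^+ 4) * t ^- 2 * (2 * pi + 2 * ln (1 + t ^+ 2)) +
  10 * ibp_bound R ^+ 3 / t ^+ 2 * fine (leb4 T4).

Lemma truncation_bound n be t al a b : 1 <= t -> 0 < a -> a <= 1 / 4 -> t * a <= 1 ->
  1 / 4 <= b ->
  `|\int[leb4]_(p in T4) truncation n be t al a b p| <= Num.sqrt t * decay_bound t.
Proof.
move=> t1 a0 a4 ta b4.
have ab : a <= b by exact: le_trans b4.
have mT := @measurable_torus4 R.
have mI : measurable (`[a, b]%classic : set mR) by [].
pose M p := \int[leb]_(tau in `[a, b]) main_integrand n be t al (p, tau).
pose E p := \int[leb]_(tau in `[a, b]) full_integrand n be t al (p, tau).
have FM (x : R4) (y : mR) : T4 x -> `[a, b]%classic y ->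
    `|full_integrand n be t al (x, y)| <= 1.
  by move=> _ _; exact: norm_full_integrand_le.
have GM (x : R4) (y : mR) : T4 x -> `[a, b]%classic y ->
    `|main_integrand n be t al (x, y)| <= 1.
  move=> _; rewrite /= in_itv/= => /andP[ay _].
  by apply: norm_main_integrand_le; rewrite (le_trans _ ay)// ltW.
have iE : leb4.-integrable T4 (EFin \o E).
  exact: (@integrable_inner1 _ _ _ _ R leb4 (lebesgue1 R) _ _ `[a, b]%classic 1
    mT mI (@leb4_torus_finite R) (segment_finite a b)
    (measurable_full_integrand n be t al) FM).
have iM : leb4.-integrable T4 (EFin \o M).
  exact: (@integrable_inner1 _ _ _ _ R leb4 (lebesgue1 R) _ _ `[a, b]%classic 1
    mT mI (@leb4_torus_finite R) (segment_finite a b)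
    (measurable_main_integrand n be t al) GM).
have iD : leb4.-integrable T4 (EFin \o (fun p => E p - M p)).
  by have := integrableB mT iE iM; apply: eq_integrable.
rewrite /truncation RintegralZl// normrM (ger0_norm (sqrtr_ge0 t)).
apply: ler_wpM2l; first exact: sqrtr_ge0.
have -> : \int[leb4]_(p in T4) E p =
    \int[leb4]_(p in T4) M p + \int[leb4]_(p in T4) (E p - M p).
  by rewrite RintegralB// addrC subrK.
apply: (le_trans (ler_normD _ _)); apply: lerD; first exact: main_term_bound.
apply: norm_Rintegral_le => //; first exact: leb4_torus_finite.
by move=> p _; exact: full_minus_main_bound.
Qed.

Definition limit_integrand n (be t al : R) p : R :=
  cos (pairing4 n p + be) * (kappa (al + t * freq p) / freq p).

Lemma symbol4_gt0 p : T4 p -> p.2 != 0 -> 0 < symbol4 p.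
Proof.
case: p => [[[a b] c] d] [[[/= aI bI] cI] dI] /= d0.
rewrite /symbol4 /=.
have := cos_le1 a; have := cos_le1 b; have := cos_le1 c.
move: dI; rewrite in_itv/= => /symbol1_ge.
have : 0 < d ^+ 2 by rewrite exprn_even_gt0.
lra.
Qed.

(** Two of the four summands of [symbol4] suffice, by the inequality between the
    arithmetic and the geometric mean, to dominate the inverse frequency by a product of
    two integrable functions of one variable each. *)
Lemma freq_inv_le p : T4 p -> p.1.2 != 0 -> p.2 != 0 ->
  (freq p)^-1 <= 4 * (inv_sqrt p.1.2 * inv_sqrt p.2).
Proof.
move=> Tp; have := symbol4_gt0 Tp.
case: p Tp => [[[a b] c] d] [[[/= aI bI] cI] dI] /= + c0 d0 => /(_ d0) S0.
rewrite !inv_sqrtE// -invfM -[4]invrK -invfM lef_pV2 ?posrE; last 2 first.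
- by rewrite sqrtr_gt0.
- by rewrite mulr_gt0 ?invr_gt0// mulr_gt0// sqrtr_gt0 normr_gt0.
rewrite -sqrtrM//.
have -> : 4^-1 * Num.sqrt (`|c| * `|d|) = Num.sqrt (16^-1 * (`|c| * `|d|)).
  rewrite [RHS]sqrtrM ?invr_ge0//; congr (_ * _).
  have -> : 16^-1 = 4^-1 ^+ 2 :> R by field.
  by rewrite sqrtr_sqr ger0_norm// invr_ge0.
rewrite ler_sqrt//; last exact: ltW.
rewrite /symbol4 /=.
have := cos_le1 a; have := cos_le1 b.
move: cI dI; rewrite !in_itv/= => /symbol1_ge hc /symbol1_ge hd.
have := sqr_ge0 (`|c| - `|d|).
have -> : (`|c| - `|d|) ^+ 2 = `|c| ^+ 2 + `|d| ^+ 2 - 2 * (`|c| * `|d|) by ring.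
rewrite !real_normK ?num_real//.
have : 0 <= `|c| * `|d| by rewrite mulr_ge0.
by move: hc hd; move: (`|c| * `|d|) (c ^+ 2) (d ^+ 2) => cd cc dd; lra.
Qed.

Lemma truncation_schlomilch t al a b p : 0 < t -> 0 < a -> a <= b -> 0 < symbol4 p ->
  Num.sqrt t * \int[leb]_(tau in `[a, b]) cos (t * phase (symbol4 p) tau + al) =
  (schlomilch (Num.sqrt t) al (freq p) b - schlomilch (Num.sqrt t) al (freq p) a) /
    (2 * freq p).
Proof.
move=> t0 a0 ab s0.
have f0 : 0 < freq p by rewrite sqrtr_gt0.
rewrite -schlomilch_integral// !sqr_sqrtr ?ltW//.
by field; rewrite gt_eqF.
Qed.

Lemma truncation_factor n be t al a b p : 0 < a ->
  truncation n be t al a b p = cos (pairing4 n p + be) *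
    (Num.sqrt t * \int[leb]_(tau in `[a, b]) cos (t * phase (symbol4 p) tau + al)).
Proof.
move=> a0; rewrite /truncation /full_integrand /= RintegralZl//.
  by ring.
apply: cont_integrable => x /andP[ax _]; apply: continuous_cos_phase.
by rewrite gt_eqF// (lt_le_trans a0).
Qed.

Lemma truncation_cvg n be t al p : 0 < t -> 0 < symbol4 p ->
  truncation n be t al k.+1%:R^-1 k.+1%:R p @[k --> \oo] -->
  limit_integrand n be t al p.
Proof.
move=> t0 s0.
have f0 : 0 < freq p by rewrite sqrtr_gt0.
have -> : limit_integrand n be t al p = cos (pairing4 n p + be) *
    (2 * kappa (al + Num.sqrt t ^+ 2 * freq p) / (2 * freq p)).
  by rewrite /limit_integrand sqr_sqrtr ?ltW//; field; rewrite gt_eqF.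
have -> : (fun k => truncation n be t al k.+1%:R^-1 k.+1%:R p) =
  (fun k => cos (pairing4 n p + be) * ((schlomilch (Num.sqrt t) al (freq p) k.+1%:R -
     schlomilch (Num.sqrt t) al (freq p) k.+1%:R^-1) / (2 * freq p))).
  apply/funext => k.
  have k0 : 0 < k.+1%:R^-1 :> R by rewrite invr_gt0.
  have k1 : k.+1%:R^-1 <= k.+1%:R :> R.
    by apply: (@le_trans _ _ 1); rewrite ?invf_le1// ler1n.
  by rewrite truncation_factor// truncation_schlomilch.
apply: cvgM; first exact: cvg_cst.
apply: cvgM; last exact: cvg_cst.
by apply: schlomilch_cvg => //; rewrite sqrtr_gt0.
Qed.

Lemma norm_truncation_le n be t al a b p : 0 < t -> 0 < a -> a <= b -> 0 < symbol4 p ->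
  `|truncation n be t al a b p| <= 2 * fresnel_bound R * (freq p)^-1.
Proof.
move=> t0 a0 ab s0.
have f0 : 0 < freq p by rewrite sqrtr_gt0.
rewrite truncation_factor// truncation_schlomilch// normrM.
have hs c : `|schlomilch (Num.sqrt t) al (freq p) c| <= 2 * fresnel_bound R.
  have -> : 2 * fresnel_bound R = fresnel_bound R + fresnel_bound R by ring.
  by apply: (le_trans (ler_normD _ _)); apply: lerD; exact: norm_fresnel_le.
have -> : 2 * fresnel_bound R * (freq p)^-1 =
  1 * ((2 * fresnel_bound R + 2 * fresnel_bound R) * (2 * freq p)^-1).
  by field; rewrite gt_eqF.
apply: ler_pM => //; first exact: cos_max.
have i0 : 0 < (2 * freq p)^-1 by rewrite invr_gt0 mulr_gt0.
rewrite normrM (gtr0_norm i0) ler_pM2r//.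
by apply: (le_trans (ler_normB _ _)); apply: lerD.
Qed.

Lemma measurable_freq : measurable_fun setT freq.
Proof.
apply: (measurableT_comp (f := @Num.sqrt R : mR -> mR)); last exact: measurable_symbol4.
by apply: continuous_measurable_fun; exact: sqrt_continuous.
Qed.

Lemma measurable_freqV : measurable_fun setT (fun p => (freq p)^-1).
Proof.
have -> : (fun p => (freq p)^-1) = (fun p => freq p `^ (-1)).
  by apply/funext => p; rewrite powR_inv1// sqrtr_ge0.
exact: (measurableT_comp (measurable_powR (-1)) measurable_freq).
Qed.

Lemma measurable_pairing_cos n be : measurable_fun setT (fun p => cos (pairing4 n p + be)).
Proof.
apply: (measurableT_comp (@measurable_cosR R)).
by apply: measurable_funD; [exact: measurable_pairing4|exact: measurable_cst].
Qed.

Lemma measurable_limit_integrand n be t al :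
  measurable_fun setT (limit_integrand n be t al).
Proof.
apply: measurable_funM; first exact: measurable_pairing_cos.
apply: measurable_funM; last exact: measurable_freqV.
have mth : measurable_fun setT (fun p => al + t * freq p).
  apply: measurable_funD; first exact: measurable_cst.
  by apply: measurable_funM; [exact: measurable_cst|exact: measurable_freq].
rewrite /kappa; apply: measurable_funD; apply: measurable_funM; try exact: measurable_cst.
  exact: (measurableT_comp (@measurable_cosR R) mth).
exact: (measurableT_comp (@measurable_sinR R) mth).
Qed.

(** A null set that contains all zeros of the frequency and all points where
    [inv_sqrt] takes its conventional value [0]. *)
Definition axis_planes : set R4 :=
  (setT `*` [set 0] `*` setT) `|` (setT `*` [set 0]).

Lemma axis_planes_null : leb4.-negligible axis_planes.
Proof.
have m0 : measurable ([set 0] : set mR) by exact: measurable_set1.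
have z1 : (lebesgue1 R) [set 0] = 0%E by exact: lebesgue_measure_set1.
have z3 : lebesgue3 R (setT `*` [set 0]) = 0%E.
  by apply: etrans (product_measure1E _ _ _ _) _ => //; rewrite [X in (_ * X)%E]z1 mule0.
apply: negligibleU.
  apply/negligibleP; first by repeat apply: measurableX.
  apply: etrans (product_measure1E _ _ _ _) _ => //; first exact: measurableX.
  by rewrite [X in (X * _)%E]z3 mul0e.
apply/negligibleP; first exact: measurableX.
by apply: etrans (product_measure1E _ _ _ _) _ => //; rewrite [X in (_ * X)%E]z1 mule0.
Qed.

Lemma integrable_dominator : leb4.-integrable T4
  (EFin \o (fun p => 2 * fresnel_bound R * (4 * (inv_sqrt p.1.2 * inv_sqrt p.2)))).
Proof.
have mI : measurable I by [].
have iw := @integrable_inv_sqrt R.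
have i1 : (lebesgue2 R).-integrable (I `*` I) (EFin \o (fun=> 1)).
  apply: (@integrable_of_bound _ _ _ _ _ _ 1); first exact: measurableX.
  - exact: leb2_finite.
  - exact: measurable_cst.
  - by move=> *; rewrite normr1.
have i3 := @integrable_prodX _ _ _ _ R (lebesgue2 R) (lebesgue1 R) _ _ _ I
  (measurableX mI mI) mI i1 iw.
have i4 := @integrable_prodX _ _ _ _ R (lebesgue3 R) (lebesgue1 R) _ _ _ I
  (measurableX (measurableX mI mI) mI) mI i3 iw.
apply: integrable_scale; first exact: measurable_torus4.
apply: integrable_scale; first exact: measurable_torus4.
apply: eq_integrable i4; first exact: measurable_torus4.
by move=> p _ /=; rewrite mul1r.
Qed.

(** Dominated convergence: off [axis_planes] the truncations converge by
    [schlomilch_cvg] and are bounded by a multiple of [1 / freq], because Fresnel integrals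
    are bounded. *)
Lemma truncation_integral_cvg n be t al : 0 < t ->
  leb4.-integrable T4 (EFin \o limit_integrand n be t al) /\
  \int[leb4]_(p in T4) truncation n be t al k.+1%:R^-1 k.+1%:R p @[k --> \oo] -->
  \int[leb4]_(p in T4) limit_integrand n be t al p.
Proof.
move=> t0.
have mT := @measurable_torus4 R.
have off p : T4 p -> ~ axis_planes p -> p.1.2 != 0 /\ p.2 != 0.
  by move=> Tp Np; split; apply/eqP => h; apply: Np; [left|right].
have fb0 : 0 <= 2 * fresnel_bound R.
  by rewrite mulr_ge0// /fresnel_bound !addr_ge0.
have [||||lim_int _ lim_cvg] := @dominated_convergence _ _ R leb4 T4 mT
    (fun k => EFin \o truncation n be t al k.+1%:R^-1 k.+1%:R)
    (EFin \o limit_integrand n be t al) _ _ _ _ integrable_dominator.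
- by move=> k; exact: measurable_int (integrable_truncation _ _ _ _ _ _).
- by apply/measurable_EFinP; apply: measurable_funTS; exact: measurable_limit_integrand.
- apply: negligibleS axis_planes_null => p /= /not_implyP[Tp nc].
  apply: contrapT => /(off _ Tp)[_ d0]; apply: nc.
  apply: cvg_EFin; first by near=> k.
  by apply: truncation_cvg => //; exact: symbol4_gt0.
- apply: negligibleS axis_planes_null => p /= np.
  apply: contrapT => Np; apply: np => k Tp.
  have [c0 d0] := off _ Tp Np.
  rewrite lee_fin; have s0 := symbol4_gt0 Tp d0.
  have k0 : 0 < k.+1%:R^-1 :> R by rewrite invr_gt0.
  have k1 : k.+1%:R^-1 <= k.+1%:R :> R.
    by apply: (@le_trans _ _ 1); rewrite ?invf_le1// ler1n.
  apply: (le_trans (norm_truncation_le n be al t0 k0 k1 s0)).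
  by apply: ler_wpM2l => //; exact: freq_inv_le.
split => //.
rewrite /Rintegral; apply: fine_cvg; rewrite fineK//.
exact: integrable_fin_num.
Unshelve. all: by end_near. Qed.

Lemma limit_bound n be t al : 1 <= t ->
  leb4.-integrable T4 (EFin \o limit_integrand n be t al) /\
  `|\int[leb4]_(p in T4) limit_integrand n be t al p| <= Num.sqrt t * decay_bound t.
Proof.
move=> t1; have t0 : 0 < t by lra.
have [iL cL] := truncation_integral_cvg n be al t0; split => //.
apply/ler_addgt0Pr => e e0.
move/cvgrPdist_le : cL => /(_ e e0) cL.
near \oo => k.
set L := \int[leb4]_(p in T4) _.
(* The bounds on [k] below make [truncation_bound] applicable to [J]. *)
have close : `|L - \int[leb4]_(p in T4) truncation n be t al k.+1%:R^-1 k.+1%:R p| <= e.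
  by near: k.
set J := \int[leb4]_(p in T4) truncation _ _ _ _ _ _ p in close.
have := ler_normD (L - J) J; rewrite subrK => tri.
suff : `|J| <= Num.sqrt t * decay_bound t by lra.
have kt : t <= k.+1%:R.
  apply: (@le_trans _ _ k%:R); last by rewrite ler_nat.
  by near: k; exact: nbhs_infty_ger.
have k4 : 4 <= k.+1%:R :> R.
  apply: (@le_trans _ _ k%:R); last by rewrite ler_nat.
  by near: k; exact: nbhs_infty_ger.
have k0 : 0 < k.+1%:R :> R by [].
apply: truncation_bound => //.
- by rewrite div1r lef_pV2 ?posrE.
- by rewrite ler_pdivrMr// mul1r.
- by move: k4; move: (k.+1%:R) => x; lra.
Unshelve. all: by end_near. Qed.

End Limit.

(** * Decay of the wave integrals *)

Section Wave.
Local Open Scope classical_set_scope.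
Context (R : realType).
Local Notation mR := (measurableTypeR R).
Local Notation R4 := (mR * mR * mR * mR)%type.
Local Notation T4 := (@torus4 R).
Local Notation leb4 := (@sigma_lebesgue4 R).
Implicit Types (n : 'I_4 -> R) (p : R4) (t : R).

Definition wave_integrand n (be t : R) p : R :=
  cos (pairing4 n p + be) * (sin (t * freq p) / freq p).

Lemma measurable_wave_integrand n be t : measurable_fun setT (wave_integrand n be t).
Proof.
apply: measurable_funM; first exact: measurable_pairing_cos.
apply: measurable_funM; last exact: measurable_freqV.
apply: (measurableT_comp (@measurable_sinR R)).
by apply: measurable_funM; [exact: measurable_cst|exact: measurable_freq].
Qed.

Lemma norm_wave_integrand_le n be t p : `|wave_integrand n be t p| <= `|t|.
Proof.
rewrite /wave_integrand normrM -[leRHS]mul1r; apply: ler_pM => //; first exact: cos_max.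
have f0 : 0 <= freq p by exact: sqrtr_ge0.
have [->|fn0] := eqVneq (freq p) 0; first by rewrite invr0 mulr0 normr0.
have fp : 0 < freq p by rewrite lt_neqAle eq_sym fn0.
rewrite normrM normfV (ger0_norm f0) ler_pdivrMr//.
by apply: (le_trans (norm_sin_le _)); rewrite normrM (ger0_norm f0).
Qed.

Lemma integrable_wave_integrand n be t : leb4.-integrable T4 (EFin \o wave_integrand n be t).
Proof.
apply: (@integrable_of_bound _ _ _ _ _ _ `|t|).
- exact: measurable_torus4.
- exact: leb4_torus_finite.
- exact: measurable_wave_integrand.
- by move=> p _; exact: norm_wave_integrand_le.
Qed.

Definition fresnel_factor : R :=
  (`|fresnel_cos R| + `|fresnel_sin R|) / (fresnel_cos R ^+ 2 + fresnel_sin R ^+ 2).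

(** [kappa_sin] expresses the sine through two of the limits. *)
Lemma wave_bound_large n be t : 1 <= t ->
  `|\int[leb4]_(p in T4) wave_integrand n be t p| <=
  fresnel_factor * (Num.sqrt t * decay_bound t).
Proof.
move=> t1; have mT := @measurable_torus4 R.
set P := fresnel_cos R ^+ 2 + fresnel_sin R ^+ 2.
have P0 : 0 < P by rewrite ltr_pwDl ?sqr_ge0// exprn_gt0// fresnel_cos_gt0.
have [i1 b1] := limit_bound n be (- (pi / 2)) t1.
have [i2 b2] := limit_bound n be 0 t1.
have -> : \int[leb4]_(p in T4) wave_integrand n be t p =
    \int[leb4]_(p in T4) (fresnel_cos R / P * limit_integrand n be t (- (pi / 2)) p +
                          fresnel_sin R / P * limit_integrand n be t 0 p).
  apply: eq_Rintegral => p _; rewrite /wave_integrand /limit_integrand.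
  have := kappa_sin (t * freq p); rewrite -/P add0r [_ - pi / 2]addrC => e.
  have -> : sin (t * freq p) = (fresnel_cos R * kappa (- (pi / 2) + t * freq p) +
      fresnel_sin R * kappa (t * freq p)) / P.
    by rewrite -e mulrAC divff ?mul1r// gt_eqF.
  by ring.
rewrite RintegralD//; [|exact: integrable_scale..].
rewrite !RintegralZl//.
apply: (le_trans (ler_normD _ _)); rewrite !normrM normfV (gtr0_norm P0).
have -> : fresnel_factor * (Num.sqrt t * decay_bound t) =
  `|fresnel_cos R| / P * (Num.sqrt t * decay_bound t) +
  `|fresnel_sin R| / P * (Num.sqrt t * decay_bound t).
  by rewrite /fresnel_factor -/P; ring.
by apply: lerD; apply: ler_wpM2l => //; rewrite divr_ge0// ltW.
Qed.

(** Reduces the comparison of powers of [t] and [1 + t] to square roots. *)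
Lemma powR_three_halves (x : R) : 0 < x -> x `^ (- (3 / 2)) = (x * Num.sqrt x)^-1.
Proof.
move=> x0; rewrite powRN; congr (_^-1).
have -> : 3 / 2 = 1 + 2^-1 :> R by field.
by rewrite powRD ?gt_eqF ?implybT// powRr1 ?ltW// powR12_sqrt// ltW.
Qed.

Definition rate (t : R) : R := (1 + `|t|) `^ (- (3 / 2)) * ln (2 + `|t|).

Lemma ln2_le t : ln 2 <= ln (2 + `|t|).
Proof. by rewrite ler_ln ?posrE ?lerDl// ltr_wpDr. Qed.

Lemma ln2_gt0 : 0 < ln 2 :> R.
Proof. by rewrite ln_gt0// ltr1n. Qed.

Lemma decay_rate_large : exists2 C : R, 0 <= C &
  forall t, 1 <= t -> Num.sqrt t * decay_bound t <= C * rate t.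
Proof.
have [B BE B0] : exists2 B : R, B = 2048 * 64 ^+ 4 & 0 <= B.
  exists (2048 * 64 ^+ 4); first by [].
  by apply: mulr_ge0; [exact: ler0n|apply: exprn_ge0; exact: ler0n].
have [M ME M0] : exists2 M : R, M = 10 * ibp_bound R ^+ 3 * fine (leb4 T4) & 0 <= M.
  exists (10 * ibp_bound R ^+ 3 * fine (leb4 T4)); first by [].
  apply: mulr_ge0; last by apply: fine_ge0; exact: measure_ge0.
  by apply: mulr_ge0; [exact: ler0n|apply: exprn_ge0; rewrite /ibp_bound; lra].
have l0 := ln2_gt0.
have pi0 : 0 <= pi :> R := pi_ge0 R.
pose D := (2 * pi * B + M) / ln 2 + 4 * B.
have D0 : 0 <= D.
  by rewrite addr_ge0// ?mulr_ge0// ?invr_ge0 ?(ltW l0)// addr_ge0// !mulr_ge0.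
exists (4 * D); first by rewrite mulr_ge0.
move=> t t1; have t0 : 0 < t by lra.
rewrite /rate (ger0_norm (ltW t0)).
set L := ln (2 + t).
have lL : ln 2 <= L by have := ln2_le t; rewrite (ger0_norm (ltW t0)).
have L0 : 0 < L by exact: lt_le_trans lL.
have one_le : 1 <= L / ln 2 by rewrite ler_pdivlMr// mul1r.
have ln_sq : ln (1 + t ^+ 2) <= 2 * L.
  have -> : 2 * L = ln ((2 + t) ^+ 2) by rewrite lnXn ?addr_gt0// mulr_natl.
  by rewrite ler_ln ?posrE ?addr_gt0 ?exprn_gt0//; [nra|lra].
have st0 : 0 < Num.sqrt t by rewrite sqrtr_gt0.
have sqt : Num.sqrt t ^+ 2 = t by rewrite sqr_sqrtr// ltW.
have -> : decay_bound t = t ^- 2 * (B * (2 * pi + 2 * ln (1 + t ^+ 2)) + M).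
  by rewrite /decay_bound -BE ME; ring.
have inner : B * (2 * pi + 2 * ln (1 + t ^+ 2)) + M <= D * L.
  have -> : D * L = (2 * pi * B + M) * (L / ln 2) + B * (4 * L).
    by rewrite /D; ring.
  have h1 : 2 * pi * B + M <= (2 * pi * B + M) * (L / ln 2).
    by apply: ler_peMr => //; rewrite addr_ge0// !mulr_ge0.
  have h2 : B * (2 * ln (1 + t ^+ 2)) <= B * (4 * L).
    by apply: ler_wpM2l => //; lra.
  have -> : B * (2 * pi + 2 * ln (1 + t ^+ 2)) = 2 * pi * B + B * (2 * ln (1 + t ^+ 2)).
    by ring.
  move: h1 h2; move: (2 * pi * B) (B * _) (B * _) ((_ + M) * _) => *; lra.
have power : Num.sqrt t * t ^- 2 <= 4 * (1 + t) `^ (- (3 / 2)).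
  rewrite powR_three_halves; last by rewrite addr_gt0.
  have -> : Num.sqrt t * t ^- 2 = (t * Num.sqrt t)^-1.
    by rewrite -{2 3}sqt; field; rewrite gt_eqF.
  have -> : 4 * ((1 + t) * Num.sqrt (1 + t))^-1 = ((1 + t) * Num.sqrt (1 + t) / 4)^-1.
    by field; rewrite !gt_eqF ?sqrtr_gt0 ?addr_gt0.
  rewrite lef_pV2 ?posrE; last 2 first.
  - by rewrite mulr_gt0.
  - by rewrite divr_gt0// mulr_gt0 ?sqrtr_gt0 ?addr_gt0.
  have s2 : Num.sqrt (1 + t) <= 2 * Num.sqrt t.
    have -> : 2 * Num.sqrt t = Num.sqrt (4 * t).
      rewrite sqrtrM//; congr (_ * _); have -> : 4 = 2 ^+ 2 :> R by ring.
      by rewrite sqrtr_sqr ger0_norm.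
    by rewrite ler_sqrt ?mulr_ge0 ?(ltW t0)//; lra.
  have : (1 + t) * Num.sqrt (1 + t) <= (2 * t) * (2 * Num.sqrt t).
    by apply: ler_pM => //; lra.
  lra.
apply: (@le_trans _ _ (Num.sqrt t * (t ^- 2 * (D * L)))).
  rewrite ler_pM2l// ler_pM2l// invr_gt0 exprn_gt0//.
have -> : Num.sqrt t * (t ^- 2 * (D * L)) = (Num.sqrt t * t ^- 2) * (D * L) by ring.
have -> : 4 * D * ((1 + t) `^ (- (3 / 2)) * L) = (4 * (1 + t) `^ (- (3 / 2))) * (D * L).
  by ring.
by apply: ler_wpM2r => //; rewrite mulr_ge0// ltW.
Qed.

Lemma rate_small t : `|t| <= 1 -> ln 2 / 4 <= rate t.
Proof.
move=> t1; have n0 := normr_ge0 t.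
have l0 := ln2_gt0.
rewrite /rate mulrC; apply: ler_pM; rewrite ?(ltW l0)//; last exact: ln2_le.
rewrite powR_three_halves; last by rewrite ltr_pwDl.
have p0 : 0 < 1 + `|t| by rewrite ltr_pwDl.
rewrite lef_pV2 ?posrE; [|by []|by rewrite mulr_gt0// sqrtr_gt0].
have -> : 4 = 2 * 2 :> R by ring.
apply: ler_pM; [lra|exact: sqrtr_ge0|lra|].
have -> : 2 = Num.sqrt (2 ^+ 2) :> R by rewrite sqrtr_sqr ger0_norm.
by rewrite ler_sqrt//; lra.
Qed.

Lemma wave_decay : exists2 C : R, 0 < C & forall n be t,
  `|\int[leb4]_(p in T4) wave_integrand n be t p| <= C * rate t.
Proof.
have [C C0 HC] := decay_rate_large.
have mT := @measurable_torus4 R.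
have l0 := ln2_gt0.
pose V : R := fine (leb4 T4).
have V0 : 0 <= V by apply: fine_ge0; exact: measure_ge0.
have F0 : 0 <= fresnel_factor by rewrite divr_ge0// addr_ge0// sqr_ge0.
pose C' := fresnel_factor * C + V * (4 / ln 2) + 1.
have rate0 t : 0 <= rate t.
  by rewrite mulr_ge0 ?powR_ge0// (le_trans (ltW l0))// ln2_le.
exists C'.
  by rewrite /C' ltr_wpDl// addr_ge0// mulr_ge0// divr_ge0// ltW.
move=> n be t.
have big s : 1 <= s -> `|\int[leb4]_(p in T4) wave_integrand n be s p| <=
    fresnel_factor * C * rate s.
  move=> s1; apply: (le_trans (wave_bound_large n be s1)).
  by rewrite -mulrA; apply: ler_wpM2l => //; exact: HC.
have [t1|t1] := leP `|t| 1.
  apply: (@le_trans _ _ (V * (4 / ln 2) * rate t)); last first.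
    apply: ler_wpM2r => //; rewrite /C'.
    by have : 0 <= fresnel_factor * C by [rewrite mulr_ge0]; lra.
  apply: (@le_trans _ _ (1 * V)).
    apply: norm_Rintegral_le => //.
    - exact: leb4_torus_finite.
    - exact: integrable_wave_integrand.
    - by move=> p _; apply: (le_trans (norm_wave_integrand_le _ _ _ _)).
  rewrite mul1r -mulrA; apply: ler_peMr => //.
  have := rate_small t1.
  have -> : 4 / ln 2 * rate t = rate t / (ln 2 / 4) by field; rewrite gt_eqF.
  by rewrite ler_pdivlMr ?divr_gt0// mul1r.
apply: (@le_trans _ _ (fresnel_factor * C * rate t)); last first.
  apply: ler_wpM2r => //; rewrite /C'.
  by have : 0 <= V * (4 / ln 2) by [rewrite mulr_ge0// divr_ge0// ltW]; lra.
have rateN : rate t = rate `|t| by rewrite /rate normr_id.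
have [t0|t0] := leP 0 t.
  by apply: big; rewrite -(ger0_norm t0) ltW.
have e : `|\int[leb4]_(p in T4) wave_integrand n be t p| =
    `|\int[leb4]_(p in T4) wave_integrand n be `|t| p|.
  have -> : \int[leb4]_(p in T4) wave_integrand n be t p =
      \int[leb4]_(p in T4) (-1 * wave_integrand n be `|t| p).
    apply: eq_Rintegral => p _; rewrite /wave_integrand ltr0_norm//.
    have -> : sin (- t * freq p) = - sin (t * freq p) by rewrite mulNr sinN.
    by ring.
  rewrite RintegralZl//; last exact: integrable_wave_integrand.
  by rewrite mulN1r normrN.
by rewrite e rateN; apply: big; exact: ltW.
Qed.

End Wave.

(** * The Green's function *)

Section Green.
Local Open Scope classical_set_scope.
Context (R : realType).
Local Notation mR := (measurableTypeR R).
Local Notation T4 := (@torus4 R).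

Lemma norm_complex_le (a b : R) : `|a +i* b| <= (`|a| + `|b|)%:C.
Proof.
rewrite normc_def lecR /=.
rewrite -[leRHS]ger0_norm ?addr_ge0// -sqrtr_sqr ler_wsqrtr//.
rewrite sqrrD !real_normK ?num_real// -addrA lerD2l lerDr.
by rewrite mulrn_wge0// mulr_ge0.
Qed.

Lemma lebesgue4E (f : (mR * mR * mR * mR)%type -> R) :
  \int[@lebesgue4 R]_(p in T4) f p = \int[sigma_lebesgue4 R]_(p in T4) f p.
Proof. by []. Qed.

(** The cosine and the sine of [x . xi] are both cosines of shifts of it. *)
Lemma green_parts (x : 'rV[int]_4) (t : R) :
  green x t = (((2 * pi) ^+ 4)^-1)%:C *
   ((\int[@lebesgue4 R]_(p in T4) wave_integrand (fun j => (x 0 j)%:~R) 0 t p) +i*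
    (\int[@lebesgue4 R]_(p in T4)
       wave_integrand (fun j => (x 0 j)%:~R) (- (pi / 2)) t p)).
Proof.
rewrite /green /Cintegral.
set A := \int[_]_(p in _) complex.Re _; set B := \int[_]_(p in _) complex.Im _.
have -> : A = \int[@lebesgue4 R]_(p in T4) wave_integrand (fun j => (x 0 j)%:~R) 0 t p.
  apply: eq_Rintegral => p _.
  rewrite dot4_pairing omega_symbol /wave_integrand /expi /= -/(freq p).
  by rewrite mulr0 subr0 addr0.
have -> : B = \int[@lebesgue4 R]_(p in T4)
    wave_integrand (fun j => (x 0 j)%:~R) (- (pi / 2)) t p.
  apply: eq_Rintegral => p _.
  rewrite dot4_pairing omega_symbol /wave_integrand /expi /= -/(freq p).
  by rewrite mulr0 add0r cosBpihalf.
by [].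
Qed.

End Green.

Unset Implicit Arguments.
Set Strict Implicit.

Theorem theorem1p1 (R : realType) :
  exists C : R, 0 < C /\
    forall (x : 'rV[int]_4) (t : R),
      `|green x t| <= (C * (1 + `|t|) `^ (- (3 / 2)) * ln (2 + `|t|))%:C.
Proof.
have [C C0 HC] := wave_decay R.
have HC' n be t :
    `|\int[@lebesgue4 R]_(p in @torus4 R) wave_integrand n be t p| <= C * rate t.
  by rewrite lebesgue4E; exact: HC.
have c0 : 0 < ((2 * pi) ^+ 4)^-1 :> R by rewrite invr_gt0 exprn_gt0// mulr_gt0// pi_gt0.
exists (((2 * pi) ^+ 4)^-1 * (2 * C)); split; first by rewrite mulr_gt0// mulr_gt0.
move=> x t; rewrite green_parts normrM.
set c := ((2 * pi) ^+ 4)^-1 in c0 *.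
have -> : `|c%:C| = c%:C by rewrite ger0_norm// lecR ltW.
have -> : c * (2 * C) * (1 + `|t|) `^ (- (3 / 2)) * ln (2 + `|t|) =
  c * (C * rate t + C * rate t) by rewrite /rate; ring.
rewrite (rmorphM (@real_complex R)); apply: ler_wpM2l; first by rewrite lecR ltW.
apply: (le_trans (norm_complex_le _ _)).
by rewrite lecR; apply: lerD; exact: HC'.
Qed.
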